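(* Let $\mathcal M=\tilde{\mathcal M}/\mathbb C^\times$ be a projective special Kähler manifold of complex dimension $n$ (arbitrary signature) as described in the context. Let $(\eta^0,\dots,\eta^n)$ be special coordinates on an open subset of $\tilde{\mathcal M}$ where $\eta^0\neq0$ and $H=c\,\eta^\alpha\partial/\partial\eta^\alpha$, with prepotential $\mathcal F(\eta)$ homogeneous of degree $2$; put $y=\eta^0$, $z^i=\eta^i/\eta^0$ ($i=1,\dots,n$), so that $z^i$ are holomorphic coordinates on $\mathcal M$. Let $\mathcal K=2\,\mathrm{Im}\!\left(\frac{\partial\mathcal F}{\partial\eta^\alpha}\bar\eta^{\alpha}\right)=\frac1{c^2}\tilde g(H,\bar H)$, let $\pm$ denote the sign of $\mathcal K$, let $g_{i\bar\jmath}=\pm\partial_{z^i}\partial_{\bar z^{\bar\jmath}}\log|\mathcal K|$ be the metric on $\mathcal M$, and let $$\Xi_{ijk}=2y^2\frac{\partial^3\mathcal F(1,z)}{\partial z^i\partial z^j\partial z^k}.$$ Then the curvature tensor $R^j{}_{ik\bar\ell}=-\partial_{\bar\ell}\Gamma^j_{ik}$ of the Levi-Civita connection of $g$ is $$R^j{}_{ik\bar\ell}=\frac1{4\mathcal K^2}\,g^{j\bar\jmath'}g^{p'\bar p}\,\Xi_{p'ki}\,\overline{\Xi_{pj'\ell}}\;\pm\;\delta_i^j\,g_{k\bar\ell}\;\pm\;\delta^j_k\,g_{i\bar\ell}.$$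
   Context: Rigid special (pseudo-)Kähler manifold: a (pseudo-)Kähler manifold $\tilde{\mathcal M}$ with metric $\tilde g$ of arbitrary signature, complex structure $\tilde J$, Kähler form $\tilde\Phi$, together with a real, flat, torsion-free connection $\tilde\nabla$ with $\tilde\nabla\tilde\Phi=0$ and $d_{\tilde\nabla}\tilde J=0$ ($\tilde J$ viewed as a $T\tilde{\mathcal M}$-valued 1-form, $d_{\tilde\nabla}$ the covariant exterior differential). Special coordinates: local holomorphic coordinates $\eta^\alpha$ for which there is a holomorphic function $\mathcal F$ (the prepotential) such that $\mathrm{Re}\,\eta^\alpha$, $8\,\mathrm{Re}(\partial\mathcal F/\partial\eta^\alpha)$ are $\tilde\nabla$-flat Darboux coordinates and $\tilde g_{\alpha\bar\beta}=\tilde g(\partial_{\eta^\alpha},\partial_{\bar\eta^\beta})=\partial_\alpha\partial_{\bar\beta}\,2\,\mathrm{Im}\big(\tfrac{\partial\mathcal F}{\partial\eta^\gamma}\bar\eta^\gamma\big)=2\,\mathrm{Im}\big(\tfrac{\partial^2\mathcal F}{\partial\eta^\alpha\partial\eta^\beta}\big)$. Projective special Kähler manifold: $\mathcal M=\tilde{\mathcal M}/\mathbb C^\times$, where $\tilde{\mathcal M}$ is rigid special (pseudo-)Kähler of complex dimension $n+1$ with a free holomorphic $\mathbb C^\times$-action (making $\tilde{\mathcal M}\to\mathcal M$ a holomorphic principal bundle) whose fundamental holomorphic vector field $H$ satisfies $\tilde\nabla_YH=cY$ for all $Y\in T^{1,0}\tilde{\mathcal M}$ ($c$ a nonzero real constant)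 and $\tilde g(H,\bar H)\ne0$ everywhere. The metric $g$ on $\mathcal M$ is the (pseudo-)Kähler metric $g_{i\bar\jmath}=\pm\partial_i\partial_{\bar\jmath}\log|\mathcal K|$; the dependence of $\log|\mathcal K|$ on $y$ is only through the additive term $\log|y|^2$, so this is well defined on $\mathcal M$. $g^{i\bar\jmath}$ is the inverse of $g_{i\bar\jmath}$, $\Gamma^j_{ik}=g^{j\bar m}\partial_i g_{k\bar m}$, and $\mathcal F(1,z)$ denotes $\mathcal F$ evaluated at $\eta^0=1$, $\eta^i=z^i$. Repeated indices are summed. *)

(* Defs.v *)
From HB Require Import structures.
From mathcomp Require Import all_boot all_order all_algebra.
From mathcomp Require Import complex.
From mathcomp Require Import all_classical all_reals all_analysis.

Set Implicit Arguments.
Unset Strict Implicit.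
Unset Printing Implicit Defensive.

Import Order.TTheory GRing.Theory Num.Theory.
Import numFieldNormedType.Exports.

Local Open Scope classical_set_scope.
Local Open Scope ring_scope.

(* Viewing [R[i]] through [numClosedFieldType] is what gives it, and the
   vector spaces ['rV[Cx R]_m], their norm topologies. *)
Definition Cx (R : realType) : numClosedFieldType := R[i].

Section Calculus.
Variable R : realType.
Local Notation C := (Cx R).
Local Notation V m := 'rV[C]_m.

Definition ofR (a : R) : C := Complex a 0.
Definition imI : C := Complex 0 1.

Section OneSpace.
Variable m : nat.

(* Complex space of dimension m, as a real vector space: all derivatives
   below are along real lines. *)
Definition dirR (f : V m -> R) (v x : V m) : R :=
  derive1 (fun t : R => f (x + ofR t *: v)) 0.

Fixpoint Ck (k : nat) (U : set (V m)) (f : V m -> R) : Prop :=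
  (forall x, U x -> {for x, continuous f}) /\
  if k is k'.+1 then
    forall v : V m,
      (forall x, U x ->
         derivable (fun t : R => f (x + ofR t *: v)) (0 : R) (1 : R)) /\
      Ck k' U (dirR f v)
  else True.

Definition smooth (U : set (V m)) (f : V m -> R) : Prop :=
  forall k, Ck k U f.

Definition smoothC (U : set (V m)) (f : V m -> C) : Prop :=
  smooth U (fun x => complex.Re (f x)) /\ smooth U (fun x => complex.Im (f x)).

Definition dirC (f : V m -> C) (v x : V m) : C :=
  Complex (dirR (fun y => complex.Re (f y)) v x)
          (dirR (fun y => complex.Im (f y)) v x).

Definition dirV p (f : V m -> V p) (v x : V m) : V p :=
  \row_j dirC (fun y => f y 0 j) v x.

Definition stdb (a : 'I_m) : V m := delta_mx 0 a.

(* Wirtinger derivatives d/dz^a and d/d(conj z)^a. *)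
Definition dz (a : 'I_m) (f : V m -> C) (x : V m) : C :=
  2^-1 * (dirC f (stdb a) x - imI * dirC f (imI *: stdb a) x).

Definition dzb (a : 'I_m) (f : V m -> C) (x : V m) : C :=
  2^-1 * (dirC f (stdb a) x + imI * dirC f (imI *: stdb a) x).

Definition holomorphic (U : set (V m)) (f : V m -> C) : Prop :=
  smoothC U f /\ forall x, U x -> forall a, dzb a f x = 0.

Definition holomorphicV p (U : set (V m)) (f : V m -> V p) : Prop :=
  forall j, holomorphic U (fun x => f x 0 j).

End OneSpace.
End Calculus.

Section ComplexManifold.
Variable R : realType.
Local Notation C := (Cx R).
Local Notation V m := 'rV[C]_m.

(* A coordinate system on an open subset [cdom]; the values of [ccoord] outside
   [cdom], and of [cparam] outside [ccoord @` cdom], are irrelevant. *)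
Record chart (X : topologicalType) (m : nat) := Chart {
  cdom : set X;
  ccoord : X -> V m;
  cparam : V m -> X }.

Section Charts.
Variables (X : topologicalType) (m : nat).
Implicit Types phi psi : chart X m.

Definition cimg phi : set (V m) := ccoord phi @` cdom phi.

Definition is_chart phi : Prop :=
  [/\ open (cdom phi), open (cimg phi),
      forall p, cdom phi p -> cparam phi (ccoord phi p) = p,
      forall p, cdom phi p -> {for p, continuous (ccoord phi)}
    & forall x, cimg phi x -> {for x, continuous (cparam phi)}].

Definition trans phi psi (x : V m) : V m := ccoord psi (cparam phi x).

Definition hol_trans phi psi : Prop :=
  holomorphicV (ccoord phi @` (cdom phi `&` cdom psi)) (trans phi psi).

End Charts.

Record complex_manifold (m : nat) := ComplexManifold {
  carrier :> topologicalType;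
  atlas : set (chart carrier m);
  mfd_hausdorff : hausdorff_space carrier;
  mfd_second_countable : @second_countable carrier;
  atlas_chart : forall phi, atlas phi -> is_chart phi;
  atlas_cover : forall p, exists2 phi, atlas phi & cdom phi p;
  atlas_compat : forall phi psi, atlas phi -> atlas psi -> hol_trans phi psi;
  atlas_max : forall phi, is_chart phi ->
    (forall psi, atlas psi -> hol_trans phi psi /\ hol_trans psi phi) ->
    atlas phi }.

(* Holomorphic functions and maps on an open subset O. *)
Definition hol_fun m (X : complex_manifold m) (O : set X) (f : X -> C) : Prop :=
  forall phi, atlas phi ->
    holomorphic (ccoord phi @` (cdom phi `&` O)) (fun x => f (cparam phi x)).

Definition hol_map m q (X : complex_manifold m) (Y : complex_manifold q)
    (O : set X) (f : X -> Y) : Prop :=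
  (forall p, O p -> {for p, continuous f}) /\
  forall phi psi, atlas phi -> atlas psi ->
    holomorphicV (ccoord phi @` (cdom phi `&` O `&` f @^-1` cdom psi))
                 (fun x => ccoord psi (f (cparam phi x))).

End ComplexManifold.

(* Tensor calculus in one holomorphic chart with image U.  Real tangent vectors
   are identified, by the differential of the chart, with vectors of complex
   m-space, the complex structure J being multiplication by [imI].  A metric is
   a function G x v w, and a real connection is given by its Christoffel form:
   nabla_u X = D_u X + Gam x u X. *)
Section LocalTensors.
Variables (R : realType) (m : nat).
Local Notation C := (Cx R).
Local Notation V := 'rV[C]_m.
Local Notation J := (fun v : V => imI R *: v).
Implicit Types (U : set V) (G : V -> V -> V -> R) (Gam : V -> V -> V -> V).

(* The convention is Phi(v, w) = g(v, J w). *)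
Definition kform G (x v w : V) : R := G x v (J w).

Record pseudo_kahler_on U G : Prop := PseudoKahlerOn {
  pk_smooth : forall v w, smooth U (fun x => G x v w);
  pk_linear : forall x, U x -> forall (a : R) (u v w : V),
    G x (ofR a *: u + v) w = a * G x u w + G x v w;
  pk_sym : forall x, U x -> forall v w, G x v w = G x w v;
  pk_nondeg : forall x, U x -> forall v, (forall w, G x v w = 0) -> v = 0;
  pk_hermitian : forall x, U x -> forall v w, G x (J v) (J w) = G x v w;
  pk_closed : forall x, U x -> forall u v w,
    dirR (fun y => kform G y v w) u x + dirR (fun y => kform G y w u) v x
      + dirR (fun y => kform G y u v) w x = 0 }.

(* On constant vector fields u, v, whose bracket vanishes, (d_nabla J)(u, v)
   is nabla_u (J v) - nabla_v (J u). *)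
Record special_connection_on U G Gam : Prop := SpecialConnectionOn {
  sc_smooth : forall u v j,
    smoothC U (fun x => Gam x u v 0 j);
  sc_linearl : forall x, U x -> forall (a : R) (u v w : V),
    Gam x (ofR a *: u + v) w = ofR a *: Gam x u w + Gam x v w;
  sc_linearr : forall x, U x -> forall (a : R) (u v w : V),
    Gam x w (ofR a *: u + v) = ofR a *: Gam x w u + Gam x w v;
  sc_torsion_free : forall x, U x -> forall u v, Gam x u v = Gam x v u;
  sc_flat : forall x, U x -> forall u v w,
    dirV (fun y => Gam y v w) u x - dirV (fun y => Gam y u w) v x
      + Gam x u (Gam x v w) - Gam x v (Gam x u w) = 0;
  sc_parallel : forall x, U x -> forall u v w,
    dirR (fun y => kform G y v w) u x
      - kform G x (Gam x u v) w - kform G x v (Gam x u w) = 0;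
  sc_dJ : forall x, U x -> forall u v, Gam x u (J v) - Gam x v (J u) = 0 }.

(* The pair (a, b) stands for the complexified tangent vector a + sqrt(-1) b. *)
Definition cconj (Y : V * V) : V * V := (Y.1, - Y.2).

(* The (1,0)-vector with components v^a in the frame d/dz^a. *)
Definition type10 (v : V) : V * V := (ofR 2^-1 *: v, - (ofR 2^-1 *: J v)).

Definition metricC (B : V -> V -> R) (Y Z : V * V) : C :=
  Complex (B Y.1 Z.1 - B Y.2 Z.2) (B Y.1 Z.2 + B Y.2 Z.1).

Definition nabla Gam (u : V) (X : V -> V) (x : V) : V :=
  dirV X u x + Gam x u (X x).

Definition nablaC Gam (Y : V * V) (Z : V -> V * V) (x : V) : V * V :=
  (nabla Gam Y.1 (fun y => (Z y).1) x - nabla Gam Y.2 (fun y => (Z y).2) x,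
   nabla Gam Y.1 (fun y => (Z y).2) x + nabla Gam Y.2 (fun y => (Z y).1) x).

Definition flat_function U Gam (f : V -> R) : Prop :=
  forall x, U x -> forall u v, dirR (dirR f v) u x - dirR f (Gam x u v) x = 0.

(* g(d/dz^a, d/d(conj z)^b) *)
Definition gcomp G (a b : 'I_m) (x : V) : C :=
  metricC (G x) (type10 (stdb R a)) (cconj (type10 (stdb R b))).

End LocalTensors.

Section RigidSpecialKahler.
Variables (R : realType) (m : nat).
Local Notation C := (Cx R).
Local Notation V := 'rV[C]_m.

(* Tensors and connections are given in every chart of the maximal atlas, with
   their transformation laws. *)
Record rigid_special_kahler := RigidSpecialKahler {
  rsk_mfd :> complex_manifold R m;
  rsk_metric : chart R rsk_mfd m -> rsk_mfd -> V -> V -> R;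
  rsk_conn : chart R rsk_mfd m -> rsk_mfd -> V -> V -> V;
  rsk_metric_trans : forall phi psi, atlas phi -> atlas psi ->
    forall p, cdom phi p -> cdom psi p -> forall v w,
    let d u := dirV (trans phi psi) u (ccoord phi p) in
    rsk_metric phi p v w = rsk_metric psi p (d v) (d w);
  rsk_conn_trans : forall phi psi, atlas phi -> atlas psi ->
    forall p, cdom phi p -> cdom psi p -> forall v w,
    let d u := dirV (trans phi psi) u (ccoord phi p) in
    d (rsk_conn phi p v w) =
      dirV (dirV (trans phi psi) w) v (ccoord phi p)
        + rsk_conn psi p (d v) (d w);
  rsk_kahler : forall phi, atlas phi ->
    pseudo_kahler_on (cimg phi) (fun x => rsk_metric phi (cparam phi x));
  rsk_special : forall phi, atlas phi ->
    special_connection_on (cimg phi)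
      (fun x => rsk_metric phi (cparam phi x))
      (fun x => rsk_conn phi (cparam phi x)) }.

Definition localG (X : rigid_special_kahler) (phi : chart R X m) (x : V) :=
  rsk_metric phi (cparam phi x).

Definition localGam (X : rigid_special_kahler) (phi : chart R X m) (x : V) :=
  rsk_conn phi (cparam phi x).

(* 2 Im (dF/deta^a conj(eta^a)) *)
Definition potential (F : V -> C) (eta : V) : R :=
  2 * complex.Im (\sum_(a < m) dz a F eta * (eta 0 a)^*).

Definition flat_x (a : 'I_m) (eta : V) : R := complex.Re (eta 0 a).

Definition flat_y (F : V -> C) (a : 'I_m) (eta : V) : R :=
  8 * complex.Re (dz a F eta).

(* The special coordinates are the components of [ccoord phi]; F is the
   prepotential written in these coordinates.  Wedge products are normalised by
   (a /\ b)(v, w) = (a(v) b(w) - a(w) b(v)) / 2: with Phi(v, w) = g(v, J w),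
   this is the convention under which Phi = dx^a /\ dy_a for x^a = flat_x a,
   y_a = flat_y F a agrees with g_{a bar b} = 2 Im F_{ab}. *)
Record special_coordinates (X : rigid_special_kahler) (phi : chart R X m)
    (F : V -> C) : Prop := SpecialCoordinates {
  spc_atlas : atlas phi;
  spc_holomorphic : holomorphic (cimg phi) F;
  spc_flat : forall a, flat_function (cimg phi) (localGam phi) (flat_x a) /\
                       flat_function (cimg phi) (localGam phi) (flat_y F a);
  spc_inj : forall eta eta', cimg phi eta -> cimg phi eta' ->
    (forall a, flat_x a eta = flat_x a eta' /\ flat_y F a eta = flat_y F a eta') ->
    eta = eta';
  spc_darboux : forall eta, cimg phi eta -> forall v w,
    kform (localG phi) eta v w =
      \sum_(a < m)
        (dirR (flat_x a) v eta * dirR (flat_y F a) w eta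
         - dirR (flat_x a) w eta * dirR (flat_y F a) v eta) / 2;
  spc_metric : forall eta, cimg phi eta -> forall a b,
    gcomp (localG phi) a b eta
      = dz a (dzb b (fun x => ofR (potential F x))) eta /\
    gcomp (localG phi) a b eta = ofR (2 * complex.Im (dz a (dz b F) eta)) }.

End RigidSpecialKahler.

Section ProjectiveSpecialKahler.
Variable R : realType.
Local Notation C := (Cx R).
Local Notation V m := 'rV[C]_m.

(* Free holomorphic action of the multiplicative group of C; [act a] is only
   meaningful for a != 0. *)
Record free_holomorphic_action m (X : complex_manifold R m) (act : C -> X -> X)
    : Prop := FreeHolomorphicAction {
  act_1 : forall p, act 1 p = p;
  act_M : forall a b p, a != 0 -> b != 0 -> act (a * b) p = act a (act b p);
  act_free : forall a p, a != 0 -> act a p = p -> a = 1;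
  act_continuous : forall a p, a != 0 ->
    {for (a, p), continuous (fun q : C * X => act q.1 q.2)};
  act_holomorphic : forall phi psi : chart R X m, atlas phi -> atlas psi ->
    let actx (x : V (1 + m)) := act (lsubmx x 0 0) (cparam phi (rsubmx x)) in
    holomorphicV
      [set x | lsubmx x 0 0 != 0 /\ cimg phi (rsubmx x) /\ cdom psi (actx x)]
      (fun x => ccoord psi (actx x)) }.

(* Components H^a, in the chart phi, of the fundamental holomorphic vector
   field H = H^a d/dz^a of the generator lambda d/dlambda. *)
Definition fundH m (X : complex_manifold R m) (act : C -> X -> X)
    (phi : chart R X m) (p : X) : V m :=
  \row_a dz ord0 (fun l : V 1 => ccoord phi (act (l 0 0) p) 0 a) (const_mx 1).

(* Holomorphic principal bundle: the fibres of pi are the orbits, and locally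
   on the base p = t(p) . s(pi p) with s and t holomorphic, so that (pi, t) is
   an equivariant biholomorphic trivialisation with inverse
   (x, l) |-> l . s(x). *)
Record principal_bundle m q (X : complex_manifold R m)
    (M : complex_manifold R q) (act : C -> X -> X) (pi : X -> M)
    : Prop := PrincipalBundle {
  pb_action : free_holomorphic_action act;
  pb_surj : forall x, exists p, pi p = x;
  pb_orbits : forall p p', pi p = pi p' <-> exists2 a, a != 0 & p' = act a p;
  pb_holomorphic : hol_map setT pi;
  pb_trivial : forall x : M, exists (W : set M) (s : M -> X) (t : X -> C),
    [/\ open W, W x, hol_map W s, hol_fun (pi @^-1` W) t &
        (forall x', W x' -> pi (s x') = x') /\
        (forall p, W (pi p) -> t p != 0 /\ p = act (t p) (s (pi p)))] }.

(* g(H, conj H) at the point p of the chart phi; by the transformation laws it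
   does not depend on phi. *)
Definition gHH m (X : rigid_special_kahler R m) (act : C -> X -> X)
    (phi : chart R X m) (p : X) : C :=
  let H := type10 (fundH act phi p) in
  metricC (rsk_metric phi p) H (cconj H).

Record projective_special_kahler (n : nat) := ProjectiveSpecialKahler {
  psk_tot : rigid_special_kahler R n.+1;
  psk_base : complex_manifold R n;
  psk_act : C -> psk_tot -> psk_tot;
  psk_proj : psk_tot -> psk_base;
  psk_c : R;
  psk_c_neq0 : psk_c != 0;
  psk_bundle : principal_bundle psk_act psk_proj;
  psk_nablaH : forall phi : chart R psk_tot n.+1, atlas phi ->
    forall x, cimg phi x -> forall v,
    nablaC (localGam phi) (type10 v)
      (fun y => type10 (fundH psk_act phi (cparam phi y))) x
    = (ofR psk_c *: (type10 v).1, ofR psk_c *: (type10 v).2);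
  psk_gHH_neq0 : forall phi : chart R psk_tot n.+1, atlas phi ->
    forall p, cdom phi p -> gHH psk_act phi p != 0 }.

End ProjectiveSpecialKahler.

(* The metric of the quotient in its local coordinates z^i = eta^i / eta^0.
   Everything is a function of (y, z), with y = eta^0 held fixed in the
   z-derivatives. *)
Section QuotientMetric.
Variables (R : realType) (n : nat).
Local Notation C := (Cx R).
Local Notation V m := 'rV[C]_m.
Variable F : V n.+1 -> C.

(* eta = (y, y z) *)
Definition hom_coord (y : C) (z : V n) : V n.+1 :=
  row_mx (const_mx y : V 1) (y *: z).

Definition aff_coord (eta : V n.+1) : V n :=
  \row_i (eta 0 (lift ord0 i) / eta 0 ord0).

Definition Kpot (y : C) (z : V n) : R := potential F (hom_coord y z).

Definition Ksign (y : C) (z : V n) : C := ofR (Num.sg (Kpot y z)).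

Definition gM (y : C) (i j : 'I_n) (z : V n) : C :=
  Ksign y z * dz i (dzb j (fun w => ofR (ln `|Kpot y w|))) z.

(* g^{i bar j}, normalised by g^{i bar j} g_{k bar j} = delta^i_k: the
   transpose of the inverse of the matrix (g_{i bar j}). *)
Definition gMinv (y : C) (i j : 'I_n) (z : V n) : C :=
  invmx (\matrix_(k, l) gM y k l z) j i.

(* Gamma^j_{ik} *)
Definition GammaM (y : C) (j i k : 'I_n) (z : V n) : C :=
  \sum_(m < n) gMinv y j m z * dz i (gM y k m) z.

(* R^j_{i k bar l} *)
Definition curvM (y : C) (j i k l : 'I_n) (z : V n) : C :=
  - dzb l (GammaM y j i k) z.

(* F(1, z) is [F (hom_coord 1 z)]. *)
Definition Xi (y : C) (i j k : 'I_n) (z : V n) : C :=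
  2 * y ^+ 2 * dz i (dz j (dz k (fun w => F (hom_coord 1 w)))) z.

End QuotientMetric.

(* Main.v *)
Require Import Defs.
From HB Require Import structures.
From mathcomp Require Import all_boot all_order all_algebra.
From mathcomp Require Import complex.
From mathcomp Require Import all_classical all_reals all_analysis.
From mathcomp Require Import ring lra.
Import Order.TTheory GRing.Theory Num.Theory.
Import numFieldNormedType.Exports.
Local Open Scope classical_set_scope.
Local Open Scope ring_scope.
Set Implicit Arguments.
Unset Strict Implicit.
Unset Printing Implicit Defensive.
(** In the affine coordinates z the prepotential becomes f(z) = F(1, z), and
    Euler's identity gives K = |y|^2 k with
    k = 2 Im (2 f - z^i f_i + conj(z^i) f_i).  Put w = z - conj z,
    theta_i = d_i log |k| and h_{ij} = d_i dbar_j log |k|, so that g = +/- h.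
    Then
      Gamma^j_{ik} = - delta^j_k theta_i - delta^j_i theta_k
                     - sqrt(-1) f_{ikp} X^{jp},
    where X is defined by X^{jp} h_{jm} = B^p_m / k with
    B^p_m = delta^p_m + w^p conj(theta_m).  As f_{ikp} is holomorphic and
    dbar_l theta_i = h_{il}, only dbar X has to be computed.  Differentiating
    the equation that defines X reduces the curvature formula to
      h^{jm} B^p_m conj(B^q_j) = h^{pq} + w^p w^q,
    which follows from h_{rq} w^q = conj(theta_r) - (1 + w.conj(theta)) theta_r
    and from the fact that h + theta conj(theta)^T is symmetric.

    The matrix h is invertible because 2 Im F_{ab} is nondegenerate, the metric
    upstairs being so, and because K does not vanish: if zeta is in the kernel of
    h then (0, zeta) minus its orthogonal projection to eta is in the kernel of
    2 Im F_{ab}.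

    Smoothness is given by derivatives along real lines; linearity of such a
    derivative in the direction and the symmetry of second derivatives come from
    the mean value theorem. *)

(** * Calculus along real lines *)

Section Scalars.
Variable R : realType.
Local Notation C := (Cx R).
Local Notation Re := (@complex.Re R).
Local Notation Im := (@complex.Im R).

Lemma ReD (x y : C) : Re (x + y) = Re x + Re y.
Proof. by case: x y => [a b] [c d]. Qed.
Lemma ImD (x y : C) : Im (x + y) = Im x + Im y.
Proof. by case: x y => [a b] [c d]. Qed.
Lemma ReN (x : C) : Re (- x) = - Re x.
Proof. by case: x. Qed.
Lemma ImN (x : C) : Im (- x) = - Im x.
Proof. by case: x. Qed.
Lemma ReM (x y : C) : Re (x * y) = Re x * Re y - Im x * Im y.
Proof. by case: x y => [a b] [c d]. Qed.
Lemma ImM (x y : C) : Im (x * y) = Re x * Im y + Im x * Re y.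
Proof. by case: x y => [a b] [c d]. Qed.
Lemma ReJ (x : C) : Re (x^*) = Re x.
Proof. by case: x. Qed.
Lemma ImJ (x : C) : Im (x^*) = - Im x.
Proof. by case: x. Qed.
Lemma ReV (x : C) : Re (x^-1) = Re x / (Re x ^+ 2 + Im x ^+ 2).
Proof. by case: x. Qed.
Lemma ImV (x : C) : Im (x^-1) = - (Im x / (Re x ^+ 2 + Im x ^+ 2)).
Proof. by case: x. Qed.
Lemma Re_ofR (a : R) : Re (ofR a) = a. Proof. by []. Qed.
Lemma Im_ofR (a : R) : Im (ofR a) = 0. Proof. by []. Qed.
Lemma Re_imI : Re (imI R) = 0. Proof. by []. Qed.
Lemma Im_imI : Im (imI R) = 1. Proof. by []. Qed.
Lemma Re0 : Re (0 : C) = 0. Proof. by []. Qed.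
Lemma Im0 : Im (0 : C) = 0. Proof. by []. Qed.
Lemma Re1 : Re (1 : C) = 1. Proof. by []. Qed.
Lemma Im1 : Im (1 : C) = 0. Proof. by []. Qed.

Definition ReImE := (ReD, ImD, ReN, ImN, ReM, ImM, ReJ, ImJ, Re_ofR, Im_ofR,
  Re_imI, Im_imI, Re0, Im0, Re1, Im1).

Lemma CxP (x y : C) : Re x = Re y -> Im x = Im y -> x = y.
Proof. by case: x y => [a b] [c d] /= -> ->. Qed.

Lemma ofRD (a b : R) : ofR (a + b) = ofR a + ofR b.
Proof. by apply: CxP; rewrite !ReImE ?addr0. Qed.
Lemma ofRM (a b : R) : ofR (a * b) = ofR a * ofR b.
Proof. by apply: CxP; rewrite !ReImE; ring. Qed.
Lemma ofRN (a : R) : ofR (- a) = - ofR a.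
Proof. by apply: CxP; rewrite !ReImE ?oppr0. Qed.
Lemma ofR0 : ofR (0 : R) = 0. Proof. by []. Qed.
Lemma ofR1 : ofR (1 : R) = 1. Proof. by []. Qed.
Lemma ofR_nat (k : nat) : ofR (k%:R : R) = k%:R.
Proof. by elim: k => // k IH; rewrite -addn1 !natrD -IH ofRD. Qed.
Lemma ofR_inj : injective (@ofR R).
Proof. by move=> a b []. Qed.
Lemma ofR_eq0 (a : R) : (ofR a == 0) = (a == 0).
Proof. by rewrite -ofR0 (inj_eq ofR_inj). Qed.
Lemma ofRV (a : R) : ofR (a^-1) = (ofR a)^-1.
Proof.
have [->|a0] := eqVneq a 0; first by rewrite ofR0 !invr0.
by apply: (mulfI (_ : ofR a != 0)); rewrite ?ofR_eq0// -ofRM !divff ?ofR_eq0.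
Qed.
Lemma conj_ofR (a : R) : (ofR a)^* = ofR a.
Proof. by apply: CxP; rewrite !ReImE ?oppr0. Qed.
Lemma conj_imI : (imI R)^* = - imI R.
Proof. by apply: CxP; rewrite !ReImE ?oppr0. Qed.
Lemma conjD (x y : C) : (x + y)^* = x^* + y^*. Proof. exact: rmorphD. Qed.
Lemma conjN (x : C) : (- x)^* = - x^*. Proof. exact: rmorphN. Qed.
Lemma conjM (x y : C) : (x * y)^* = x^* * y^*. Proof. exact: rmorphM. Qed.
Lemma conjV (x : C) : (x^-1)^* = (x^*)^-1. Proof. exact: fmorphV. Qed.
Lemma conj_sum (I : Type) (r : seq I) (P : pred I) (f : I -> C) :
  (\sum_(i <- r | P i) f i)^* = \sum_(i <- r | P i) (f i)^*.
Proof. exact: rmorph_sum. Qed.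
Lemma conj_nat (k : nat) : (k%:R : C)^* = k%:R. Proof. exact: rmorph_nat. Qed.
Lemma conj0 : (0 : C)^* = 0. Proof. exact: rmorph0. Qed.
Lemma conj1 : (1 : C)^* = 1. Proof. exact: rmorph1. Qed.
Definition conjE := (conj0, conj1, conjD, conjN, conjM, conjV, conj_sum, conj_nat, conj_imI,
  conj_ofR, @conjCK C).

Lemma conj_div (x y : C) : (x / y)^* = x^* / y^*.
Proof. by rewrite conjM conjV. Qed.
Lemma conj_mulJ (x y : C) : (x * y^*)^* = x^* * y.
Proof. by rewrite conjM conjCK. Qed.

Lemma imI2 : imI R * imI R = -1.
Proof. by apply: CxP; rewrite !ReImE; ring. Qed.
Lemma ReImC (x : C) : x = ofR (Re x) + imI R * ofR (Im x).
Proof. by apply: CxP; rewrite !ReImE; ring. Qed.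

Lemma ofR_Im (x : C) : ofR (2 * Im x) = - imI R * (x - x^*).
Proof. by apply: CxP; rewrite !ReImE; ring. Qed.

Lemma norm_ofR (a : R) : `|ofR a| = ofR `|a|.
Proof. by rewrite normc_def /= expr0n/= addr0 sqrtr_sqr. Qed.

Lemma ofR_continuous : continuous (@ofR R).
Proof.
move=> a; apply/(@cvgrPdist_lt _ C) => /= e e0.
(* A positive element of [Cx R] is real, so the radius [e] is the image of a positive real
   number. *)
have [e1 e2] : Im e = 0 /\ 0 < Re e by move: e0; rewrite ltcE /= => /andP[/eqP-> ->].
have -> : e = ofR (Re e) by apply: CxP.
near=> b; rewrite -ofRN -ofRD norm_ofR ltcR.
by near: b; apply: (@cvgr_dist_lt _ R^o).
Unshelve. all: by end_near. Qed.

(** * Neighbourhoods along real lines and in real planes *)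

Section Lines.
Variable m : nat.
Local Notation V := 'rV[C]_m.

Lemma plane_cvg (x u v : V) :
  (x + ofR st.1 *: u + ofR st.2 *: v) @[st --> (0 : R, 0 : R)] --> x.
Proof.
have h (w : V) (k : R * R -> R) : k st @[st --> (0 : R, 0 : R)] --> (0 : R) ->
    ofR (k st) *: w @[st --> (0 : R, 0 : R)] --> (0 : V).
  move=> hk; rewrite -[X in _ --> X](scale0r w).
  apply: cvgZr_tmp; rewrite -ofR0.
  by apply: (cvg_comp _ _ hk); exact: ofR_continuous.
suff : (x + ofR st.1 *: u + ofR st.2 *: v) @[st --> (0 : R, 0 : R)]
    --> x + 0 + 0 by rewrite !addr0.
apply: cvgD; last by apply: h; exact: cvg_snd.
apply: cvgD; last by apply: h; exact: cvg_fst.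
exact: cvg_cst.
Qed.

(** One radius serves for both parameters: the mean value theorem is applied on the sides of a
    parameter square that must stay inside [N]. *)
Lemma plane_nbhs (x u v : V) (N : set V) : nbhs x N ->
  exists2 e : R, 0 < e &
    forall s t, `|s| < e -> `|t| < e -> N (x + ofR s *: u + ofR t *: v).
Proof.
move=> xN; have /= := @plane_cvg x u v N xN.
move=> /(@nbhs_ballP _ (R * R)%type)[e /= e0 be].
exists e => // s t hs ht; apply: (be (s, t)); split => /=;
  by rewrite /ball/= sub0r normrN.
Qed.

Lemma line_nbhs (x v : V) (N : set V) : nbhs x N ->
  exists2 e : R, 0 < e & forall t, `|t| < e -> N (x + ofR t *: v).
Proof.
move=> /(@plane_nbhs x 0 v)[e e0 h]; exists e => // t ht.
by have := h 0 t; rewrite scaler0 addr0 normr0; apply.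
Qed.

Lemma line_near (x v : V) (N : set V) : nbhs x N ->
  \forall t \near (0 : R), N (x + ofR t *: v).
Proof.
move=> /(@line_nbhs x v)[e e0 h]; near=> t; apply: h.
by near: t; apply: (@nbhs0_lt _ R^o).
Unshelve. all: by end_near. Qed.

End Lines.
End Scalars.

(** * Derivatives along real lines, mean values and mixed derivatives *)

Section RealLines.
Variable R : realType.
Local Notation C := (Cx R).
Local Notation isd g d := (is_derive (0 : R) (1 : R) (g : R -> R) (d : R)).

(** The difference quotient is multiplied out by [h], the form in which mean value estimates
    arrive. *)
Lemma isd_limit (g : R -> R) (l : R) :
  (forall e, 0 < e -> exists2 d, 0 < d &
     forall h, h != 0 -> `|h| < d -> `|g h - g 0 - h * l| <= e * `|h|) ->
  isd g l.
Proof.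
move=> H.
have cv : h^-1 *: ((g \o shift 0) (h *: (1 : R)) - g 0) @[h --> 0^'] --> l.
  apply/cvgrPdist_le => e e0; have [d d0 hd] := H _ e0.
  near=> h.
  have h0 : h != 0 by near: h; exact: nbhs_dnbhs_neq.
  have -> : (h^-1 *: ((g \o shift 0) (h *: (1 : R)) - g 0) : R)
      = h^-1 * (g h - g 0) by rewrite /= addr0 /GRing.scale/= mulr1.
  have -> : l - h^-1 * (g h - g 0) = - (h^-1 * (g h - g 0 - h * l)) by field.
  rewrite normrN normrM normfV mulrC ler_pdivrMr ?normr_gt0//.
  apply: hd => //; near: h; exact: dnbhs0_lt.
split; first by apply/cvg_ex; exists l.
exact: cvg_lim cv.
Unshelve. all: by end_near. Qed.

Lemma isd_dir m (f : 'rV[C]_m -> R) v x d :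
  isd (fun t => f (x + ofR t *: v)) d -> dirR f v x = d.
Proof. by move=> h; rewrite /dirR derive1E; exact: derive_val. Qed.

Lemma derivable_isd m (f : 'rV[C]_m -> R) v x :
  derivable (fun t : R => f (x + ofR t *: v)) (0 : R) (1 : R) ->
  isd (fun t => f (x + ofR t *: v)) (dirR f v x).
Proof. by move=> h; rewrite /dirR derive1E; exact: derivableP. Qed.

Lemma isd_near (f g : R -> R) d :
  (\forall t \near (0 : R), f t = g t) -> isd f d -> isd g d.
Proof. by move=> fg; apply: near_eq_is_derive. Qed.

Lemma isd_eq (f : R -> R) d d' : isd f d -> d = d' -> isd f d'.
Proof. by move=> h <-. Qed.

(** [Ck] only speaks of derivatives at parameter 0; moving the base point along the line gives them
    at every parameter, as the mean value theorem requires. *)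
Lemma isd_line_shift m (f : 'rV[C]_m -> R) x v (t0 d : R) :
  isd (fun t => f (x + ofR t0 *: v + ofR t *: v)) d ->
  is_derive t0 (1 : R) (fun t => f (x + ofR t *: v)) d.
Proof.
move=> h; set g := (fun t => _) in h.
have -> : (fun t => f (x + ofR t *: v)) = g \o (fun t => t - t0).
  apply/funext => t /=; rewrite /g -addrA -scalerDl -ofRD; congr (f (_ + ofR _ *: _)).
  by ring.
rewrite -[d]mulr1; apply: is_derive1_comp; first by rewrite subrr.
by rewrite -[X in is_derive _ _ _ X]subr0; apply: is_deriveB.
Qed.

(** A mean value theorem for increments of either sign. The intermediate point is located by
    absolute value only, which suffices for estimates on a square around 0. *)
Lemma mvt_sym (g dg : R -> R) (h : R) :
  (forall t, `|t| <= `|h| -> is_derive t (1 : R) g (dg t)) ->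
  exists2 c, `|c| <= `|h| & g h - g 0 = h * dg c.
Proof.
move=> H; have [h0|h0] := leP 0 h.
  have [||c] := @MVT_segment R g dg 0 h h0.
  - move=> t; rewrite in_itv/= => /andP[t0 th]; apply: H.
    by rewrite !ger0_norm// ltW.
  - apply: derivable_within_continuous => t; rewrite in_itv/= => /andP[t0 th].
    by apply: (@ex_derive _ _ _ _ _ _ (dg t)); apply: H; rewrite !ger0_norm.
  - rewrite in_itv/= => /andP[c0 ch] ->; exists c; first by rewrite !ger0_norm.
    by rewrite subr0 mulrC.
have [||c] := @MVT_segment R g dg h 0 (ltW h0).
- move=> t; rewrite in_itv/= => /andP[t0 th]; apply: H.
  by rewrite !ler0_norm ?lerN2 ?ltW.
- apply: derivable_within_continuous => t; rewrite in_itv/= => /andP[t0 th].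
  apply: (@ex_derive _ _ _ _ _ _ (dg t)); apply: H.
  by rewrite !ler0_norm ?lerN2// ltW.
- rewrite in_itv/= => /andP[c0 ch] E; exists c.
    by rewrite !ler0_norm ?lerN2// ltW.
  by rewrite -opprB E sub0r mulrN opprK mulrC.
Qed.

Section Space.
Variable m : nat.
Local Notation V := 'rV[C]_m.
Implicit Types (f g : V -> R) (U : set V).

Lemma Ck_continuous k U f x : Ck k U f -> U x -> {for x, continuous f}.
Proof. by case: k => [|k] [h _]; exact: h. Qed.

Lemma Ck_isd k U f v x : Ck k.+1 U f -> U x ->
  isd (fun t => f (x + ofR t *: v)) (dirR f v x).
Proof. by move=> [_ /(_ v)[h _]] Ux; apply: derivable_isd; exact: h. Qed.

Lemma Ck_dirR k U f v : Ck k.+1 U f -> Ck k U (dirR f v).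
Proof. by move=> [_ /(_ v)[_ h]]. Qed.

Lemma smooth_isd U f v x : smooth U f -> U x ->
  isd (fun t => f (x + ofR t *: v)) (dirR f v x).
Proof. by move=> /(_ 1%N); exact: Ck_isd. Qed.

Lemma smooth_dirR U f v : smooth U f -> smooth U (dirR f v).
Proof. by move=> h k; exact: Ck_dirR (h k.+1). Qed.

Lemma smooth_continuous U f x : smooth U f -> U x -> {for x, continuous f}.
Proof. by move=> /(_ 0%N); exact: Ck_continuous. Qed.

Lemma dirR_near f g v x : (\forall x' \near x, f x' = g x') ->
  dirR f v x = dirR g v x.
Proof.
move=> fg; rewrite /dirR !derive1E; apply: near_eq_derive.
exact: (@line_near R m x v _ fg).
Qed.

Lemma Ck_line_diff k U f x u v (s t : R) : Ck k.+1 U f ->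
  U (x + ofR s *: u + ofR t *: v) ->
  is_derive t (1 : R) (fun t => f (x + ofR s *: u + ofR t *: v))
    (dirR f v (x + ofR s *: u + ofR t *: v)).
Proof. by move=> fC Up; apply: isd_line_shift; exact: Ck_isd fC Up. Qed.

Lemma Ck_line_diff1 k U f x u v (s t : R) : Ck k.+1 U f ->
  U (x + ofR s *: u + ofR t *: v) ->
  is_derive s (1 : R) (fun s => f (x + ofR s *: u + ofR t *: v))
    (dirR f u (x + ofR s *: u + ofR t *: v)).
Proof.
move=> fC Up.
have Up' : U (x + ofR t *: v + ofR s *: u) by rewrite addrAC.
have <- : dirR f u (x + ofR t *: v + ofR s *: u) =
          dirR f u (x + ofR s *: u + ofR t *: v).
  by congr (dirR _ _ _); exact: addrAC.
have -> : (fun s => f (x + ofR s *: u + ofR t *: v)) =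
          (fun s => f (x + ofR t *: v + ofR s *: u)).
  by apply/funext => r; rewrite addrAC.
exact: Ck_line_diff fC Up'.
Qed.

Lemma isdD (f g : R -> R) a b : isd f a -> isd g b -> isd (fun t => f t + g t) (a + b).
Proof. by move=> h1 h2; exact: is_deriveD. Qed.
Lemma isdB (f g : R -> R) a b : isd f a -> isd g b -> isd (fun t => f t - g t) (a - b).
Proof. by move=> h1 h2; exact: is_deriveB. Qed.
Lemma isdN (f : R -> R) a : isd f a -> isd (fun t => - f t) (- a).
Proof. by move=> h1; exact: is_deriveN. Qed.
Lemma isdM (f g : R -> R) a b : isd f a -> isd g b ->
  isd (fun t => f t * g t) (a * g 0 + f 0 * b).
Proof.
move=> h1 h2; have := is_deriveM h1 h2; rewrite /GRing.scale/= addrC.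
by rewrite [g 0 * a]mulrC.
Qed.
Lemma isd_cst (a : R) : isd (fun=> a) 0.
Proof. exact: is_derive_cst. Qed.

Lemma isd_uniq (f : R -> R) a b : isd f a -> isd f b -> a = b.
Proof. by move=> [_ <-] [_ <-]. Qed.

Lemma is_deriveB' (x : R) (f g : R -> R) a b : is_derive x (1 : R) f a ->
  is_derive x (1 : R) g b -> is_derive x (1 : R) (fun t => f t - g t) (a - b).
Proof. by move=> h1 h2; exact: is_deriveB. Qed.

Lemma cvg_dist f x e : {for x, continuous f} -> 0 < e ->
  \forall x' \near x, `|f x' - f x| < e.
Proof.
move=> /cvgrPdist_lt/(_ e) + e0 => /(_ e0) fx.
by apply: filterS fx => x'; rewrite distrC.
Qed.

Lemma telescope_diff (h r0 r1 r2 s1 s2 d1 d2 : R) :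
  r2 - r1 = h * s2 -> r1 - r0 = h * s1 ->
  r2 - r0 - h * (d1 + d2) = h * ((s2 - d2) + (s1 - d1)).
Proof.
move=> e2 e1; have -> : r2 - r0 = (r2 - r1) + (r1 - r0) by rewrite addrA subrK.
by rewrite e1 e2; ring.
Qed.

(** The step from [x] to [x + h (u + v)] is made first along [u], then along [v]. Each leg gives a
    mean value, and continuity of both directional derivatives at [x] makes the error small relative
    to [h]. *)
Lemma isd_dirD U f u v x : open U -> U x -> Ck 1 U f ->
  isd (fun t => f (x + ofR t *: (u + v))) (dirR f u x + dirR f v x).
Proof.
move=> oU Ux fC; apply: isd_limit => e e0.
have e20 : 0 < e / 2 by rewrite divr_gt0.
have near_x : nbhs x [set x' | U x' /\ (`|dirR f u x' - dirR f u x| < e / 2 /\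
    `|dirR f v x' - dirR f v x| < e / 2)].
  apply: filterI; first exact: open_nbhs_nbhs.
  by apply: filterI; apply: (cvg_dist _ e20);
    exact: Ck_continuous (Ck_dirR _ fC) Ux.
have [d d0 hd] := plane_nbhs u v near_x.
exists d => // h h0 hltd.
have d00 : `|0 : R| < d by rewrite normr0.
have [c ch E1] : exists2 c : R, `|c| <= `|h| &
    f (x + ofR h *: u + ofR h *: v) - f (x + ofR h *: u) =
    h * dirR f v (x + ofR h *: u + ofR c *: v).
  have := @mvt_sym (fun t => f (x + ofR h *: u + ofR t *: v))
    (fun t => dirR f v (x + ofR h *: u + ofR t *: v)) h.
  rewrite scale0r addr0; apply => t ht; apply: Ck_line_diff fC _.
  by have [] := hd h t hltd (le_lt_trans ht hltd).
have [c' ch' E2] : exists2 c : R, `|c| <= `|h| &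
    f (x + ofR h *: u) - f x = h * dirR f u (x + ofR c *: u).
  have := @mvt_sym (fun t => f (x + ofR t *: u))
    (fun t => dirR f u (x + ofR t *: u)) h.
  rewrite scale0r addr0; apply => t ht.
  have := @Ck_line_diff 0 U f x 0 u 0 t fC; rewrite scaler0 !addr0; apply.
  have := hd t 0 (le_lt_trans ht hltd) d00.
  by rewrite scale0r addr0 => -[].
have [_ [_ h1]] := hd h c hltd (le_lt_trans ch hltd).
have := hd c' 0 (le_lt_trans ch' hltd) d00.
rewrite scale0r addr0 => -[_ [h2 _]].
rewrite ofR0 scale0r addr0 scalerDr addrA.
have -> : f (x + ofR h *: u + ofR h *: v) - f x - h * (dirR f u x + dirR f v x)
  = h * ((dirR f v (x + ofR h *: u + ofR c *: v) - dirR f v x)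
       + (dirR f u (x + ofR c' *: u) - dirR f u x)).
  exact: telescope_diff E1 E2.
rewrite normrM mulrC; apply: ler_wpM2r; first exact: normr_ge0.
apply: le_trans (ler_normD _ _) _; rewrite (splitr e).
by apply: lerD; [exact: (ltW h1)|exact: (ltW h2)].
Qed.

Lemma isd_dirZ U f (a : R) v x : U x -> Ck 1 U f ->
  isd (fun t => f (x + ofR t *: (ofR a *: v))) (a * dirR f v x).
Proof.
move=> Ux fC.
have -> : (fun t : R => f (x + ofR t *: (ofR a *: v))) =
          (fun t => f (x + ofR t *: v)) \o (fun t => t * a).
  by apply/funext => t /=; rewrite scalerA -ofRM.
rewrite mulrC; apply: is_derive1_comp; first by rewrite mul0r; exact: Ck_isd fC Ux.
have := @isdM id (cst a) 1 0 _ _; rewrite mul1r mulr0 addr0 /=; apply.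
Qed.

(* Both mixed derivatives are limits of the same second difference quotient. *)
Lemma dirR_comm U f u v x : open U -> U x -> Ck 2 U f ->
  dirR (dirR f u) v x = dirR (dirR f v) u x.
Proof.
(* If the two values differ by [D > 0], continuity keeps each mixed derivative within [D / 2] of its
   value at [x]; a common value taken at nearby points then gives [D < D]. *)
move=> oU Ux fC; apply/eqP; rewrite -subr_eq0 -normr_le0 leNgt; apply/negP => D0.
set D := `|_| in D0; have e0 : 0 < D / 2 by rewrite divr_gt0.
have fC1 w : Ck 1 U (dirR f w) := Ck_dirR w fC.
have near_x : nbhs x [set x' | U x' /\
    (`|dirR (dirR f u) v x' - dirR (dirR f u) v x| < D / 2 /\
     `|dirR (dirR f v) u x' - dirR (dirR f v) u x| < D / 2)].
  apply: filterI; first exact: open_nbhs_nbhs.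
  by apply: filterI; apply: (cvg_dist _ e0);
    exact: Ck_continuous (Ck_dirR _ (fC1 _)) Ux.
have [d d0 hd] := plane_nbhs u v near_x.
have [h h0 hltd] : exists2 h : R, 0 < h & `|h| < d.
  by exists (d / 2); rewrite ?divr_gt0// gtr0_norm ?divr_gt0// gtr_pMr// invf_lt1// ltr1n.
have hd1 s t : `|s| <= `|h| -> `|t| <= `|h| -> U (x + ofR s *: u + ofR t *: v).
  by move=> hs ht; have [] := hd s t (le_lt_trans hs hltd) (le_lt_trans ht hltd).
have h00 : `|0 : R| <= `|h| by rewrite normr0.
(* [E1] and [E3] evaluate the second difference first in [s] and then in [t]; [E2] and [E4] do so in
   the opposite order. Each pair yields [h * h] times one mixed derivative at a point of the
   square. *)
have [c ch E1] := @mvt_sym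
  (fun s => f (x + ofR s *: u + ofR h *: v) - f (x + ofR s *: u + ofR 0 *: v))
  (fun s => dirR f u (x + ofR s *: u + ofR h *: v)
            - dirR f u (x + ofR s *: u + ofR 0 *: v)) h
  (fun s hs => is_deriveB' (Ck_line_diff1 fC (hd1 s h hs (lexx _)))
                           (Ck_line_diff1 fC (hd1 s 0 hs h00))).
have [c' ch' E2] := @mvt_sym
  (fun t => f (x + ofR h *: u + ofR t *: v) - f (x + ofR 0 *: u + ofR t *: v))
  (fun t => dirR f v (x + ofR h *: u + ofR t *: v)
            - dirR f v (x + ofR 0 *: u + ofR t *: v)) h
  (fun t ht => is_deriveB' (Ck_line_diff fC (hd1 h t (lexx _) ht))
                           (Ck_line_diff fC (hd1 0 t h00 ht))).
have [b bh E3] := @mvt_sym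
  (fun t => dirR f u (x + ofR c *: u + ofR t *: v))
  (fun t => dirR (dirR f u) v (x + ofR c *: u + ofR t *: v)) h
  (fun t ht => Ck_line_diff (fC1 u) (hd1 c t ch ht)).
have [b' bh' E4] := @mvt_sym
  (fun s => dirR f v (x + ofR s *: u + ofR c' *: v))
  (fun s => dirR (dirR f v) u (x + ofR s *: u + ofR c' *: v)) h
  (fun s hs => Ck_line_diff1 (fC1 v) (hd1 s c' hs ch')).
cbv beta in E1, E2, E3, E4.
have alg (r1 r2 r3 r4 : R) : r1 - r2 - (r3 - r4) = r1 - r3 - (r2 - r4) by ring.
have E : dirR (dirR f u) v (x + ofR c *: u + ofR b *: v) =
         dirR (dirR f v) u (x + ofR b' *: u + ofR c' *: v).
  have hn0 : h != 0 by rewrite gt_eqF.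
  apply: (mulfI hn0); apply: (mulfI hn0).
  apply: etrans (congr1 ( *%R h) (esym E3)) _.
  apply: etrans _ (congr1 ( *%R h) E4).
  apply: etrans (esym E1) _; apply: etrans _ E2.
  exact: alg.
have [_ [h1 _]] := hd c b (le_lt_trans ch hltd) (le_lt_trans bh hltd).
have [_ [_ h2]] := hd b' c' (le_lt_trans bh' hltd) (le_lt_trans ch' hltd).
suff : D < D / 2 + D / 2 by rewrite -splitr ltxx.
apply: le_lt_trans (ltrD h1 h2); rewrite E -[X in _ <= X + _]normrN.
apply: le_trans (ler_normD _ _).
by rewrite /D opprB addrA subrK.
Qed.

End Space.
End RealLines.
(** * Wirtinger derivatives *)

Section ComplexLines.
Variable R : realType.
Local Notation C := (Cx R).
Local Notation Re := (@complex.Re R).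
Local Notation Im := (@complex.Im R).
Local Notation isd g d := (is_derive (0 : R) (1 : R) (g : R -> R) (d : R)).

Definition isdC (g : R -> C) (d : C) : Prop :=
  isd (fun t => Re (g t)) (Re d) /\ isd (fun t => Im (g t)) (Im d).

Lemma isdC_eq (g : R -> C) d d' : isdC g d -> d = d' -> isdC g d'.
Proof. by move=> h <-. Qed.

Lemma isdC_uniq (g : R -> C) d d' : isdC g d -> isdC g d' -> d = d'.
Proof. by move=> [h1 h2] [h3 h4]; apply: CxP; [exact: isd_uniq h1 h3|exact: isd_uniq h2 h4]. Qed.

Lemma isdC_near (f g : R -> C) d : (\forall t \near (0 : R), f t = g t) ->
  isdC f d -> isdC g d.
Proof.
by move=> fg [h1 h2]; split; [apply: isd_near h1|apply: isd_near h2];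
  apply: filterS fg => t ->.
Qed.

Lemma isdC_cst (c : C) : isdC (fun=> c) 0.
Proof. by split; exact: isd_cst. Qed.

Lemma isdCD f g a b : isdC f a -> isdC g b -> isdC (fun t => f t + g t) (a + b).
Proof.
move=> [h1 h2] [h3 h4]; split; rewrite !ReImE; under eq_fun do rewrite !ReImE.
  exact: isdD.
exact: isdD.
Qed.

Lemma isdCN f a : isdC f a -> isdC (fun t => - f t) (- a).
Proof.
move=> [h1 h2]; split; rewrite !ReImE; under eq_fun do rewrite !ReImE.
  exact: isdN.
exact: isdN.
Qed.

Lemma isdCJ f a : isdC f a -> isdC (fun t => (f t)^*) (a^*).
Proof.
move=> [h1 h2]; split; rewrite !ReImE; under eq_fun do rewrite !ReImE.
  exact: h1.
exact: isdN.
Qed.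

Lemma isdCM f g a b : isdC f a -> isdC g b ->
  isdC (fun t => f t * g t) (a * g 0 + f 0 * b).
Proof.
move=> [h1 h2] [h3 h4]; split; under eq_fun do rewrite !ReImE.
  by apply: (isd_eq (isdB (isdM h1 h3) (isdM h2 h4))); rewrite !ReImE; ring.
by apply: (isd_eq (isdD (isdM h1 h4) (isdM h2 h3))); rewrite !ReImE; ring.
Qed.

Lemma isdV (f : R -> R) a : f 0 != 0 -> isd f a ->
  isd (fun t => (f t)^-1) (- (f 0) ^- 2 * a).
Proof. by move=> f0 h; exact: is_deriveV. Qed.

Lemma isdCV f a : f 0 != 0 -> isdC f a ->
  isdC (fun t => (f t)^-1) (- (f 0) ^- 2 * a).
Proof.
move=> f0 [h1 h2].
have n0 : Re (f 0) ^+ 2 + Im (f 0) ^+ 2 != 0.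
  apply: contra f0; rewrite paddr_eq0 ?sqr_ge0// !sqrf_eq0 => /andP[/eqP e1 /eqP e2].
  by apply/eqP; apply: CxP.
have hn : isd (fun t => Re (f t) ^+ 2 + Im (f t) ^+ 2)
    (2 * (Re (f 0) * Re a + Im (f 0) * Im a)).
  under eq_fun do rewrite !expr2.
  by apply: (isd_eq (isdD (isdM h1 h1) (isdM h2 h2))); ring.
have hV := isdV n0 hn; rewrite !expr2 in n0.
split; [under eq_fun do rewrite ReV|under eq_fun do rewrite ImV].
  apply: (isd_eq (isdM h1 hV)).
  by rewrite -!exprVn !expr2 !ReImE ReV ImV !expr2; field.
apply: (isd_eq (isdN (isdM h2 hV))).
by rewrite -!exprVn !expr2 !ReImE ReV ImV !expr2; field.
Qed.

(** [ln |u|] is half of [ln (u * u)], which is differentiable whatever the sign of [u]. *)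
Lemma isd_ln_norm (u : R -> R) d : u 0 != 0 -> isd u d ->
  isd (fun t => ln `|u t|) (d / u 0).
Proof.
move=> u0 h.
have u20 : 0 < u 0 * u 0 by rewrite -expr2 exprn_even_gt0.
have hln := @is_derive1_comp R (@ln R) (fun t => u t * u t) 0 _ _
  (is_derive1_ln u20) (isdM h h).
have -> : (fun t => ln `|u t|) = (fun t => 2^-1 * (@ln R \o (fun t => u t * u t)) t).
  (* The convention [ln 0 = 0] makes the identity hold also where [u] vanishes. *)
  apply/funext => t /=; have [->|ut0] := eqVneq (u t) 0.
    by rewrite normr0 mul0r ln0// mulr0.
  rewrite -expr2 -[u t ^+ 2]ger0_norm ?sqr_ge0// normrX lnXn ?normr_gt0//.
  by move: (ln _) => r; rewrite -[r *+ 2]mulr_natl mulKf// pnatr_eq0.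
apply: (isd_eq (isdM (isd_cst 2^-1) hln)); rewrite mul0r add0r.
by field.
Qed.

Lemma isdC_dir m (f : 'rV[C]_m -> C) v x d :
  isdC (fun t => f (x + ofR t *: v)) d -> dirC f v x = d.
Proof.
by move=> [h1 h2]; apply: CxP; rewrite /dirC /=;
  apply: (@isd_dir _ _ (fun y => _ (f y))).
Qed.

Section Wirtinger.
Variable m : nat.
Local Notation V := 'rV[C]_m.
Implicit Types (f g : V -> C) (x : V) (a : 'I_m).

(* The real directional derivatives of f at x along the a-th complex axis exist,
   with d = df/dz^a and d' = df/d(conj z)^a. *)
Definition isW a f x (d d' : C) : Prop :=
  isdC (fun t => f (x + ofR t *: stdb R a)) (d + d') /\
  isdC (fun t => f (x + ofR t *: (imI R *: stdb R a))) (imI R * (d - d')).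

Lemma isW_eq a f x d d' e e' : isW a f x d d' -> d = e -> d' = e' -> isW a f x e e'.
Proof. by move=> h <- <-. Qed.

Lemma isW_dz a f x d d' : isW a f x d d' -> dz a f x = d.
Proof.
move=> [/isdC_dir h1 /isdC_dir h2]; rewrite /dz h1 h2 mulrA imI2.
by field.
Qed.

Lemma isW_dzb a f x d d' : isW a f x d d' -> dzb a f x = d'.
Proof.
move=> [/isdC_dir h1 /isdC_dir h2]; rewrite /dzb h1 h2 mulrA imI2.
by field.
Qed.

Lemma isW_near a f g x d d' : (\forall x' \near x, f x' = g x') ->
  isW a f x d d' -> isW a g x d d'.
Proof.
move=> fg [h1 h2]; split; [apply: isdC_near h1|apply: isdC_near h2];
  exact: (line_near _ fg).
Qed.

Lemma line0 x v : x + ofR 0 *: v = x :> V.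
Proof. by rewrite ofR0 scale0r addr0. Qed.

Lemma isW_cst a c x : isW a (fun=> c) x 0 0.
Proof. by split; apply: (isdC_eq (isdC_cst c)); ring. Qed.

Lemma isWD a f g x d d' e e' : isW a f x d d' -> isW a g x e e' ->
  isW a (fun y => f y + g y) x (d + e) (d' + e').
Proof.
move=> [h1 h2] [h3 h4]; split; first by apply: (isdC_eq (isdCD h1 h3)); ring.
by apply: (isdC_eq (isdCD h2 h4)); ring.
Qed.

Lemma isWN a f x d d' : isW a f x d d' -> isW a (fun y => - f y) x (- d) (- d').
Proof.
move=> [h1 h2]; split; first by apply: (isdC_eq (isdCN h1)); ring.
by apply: (isdC_eq (isdCN h2)); ring.
Qed.

Lemma isWB a f g x d d' e e' : isW a f x d d' -> isW a g x e e' ->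
  isW a (fun y => f y - g y) x (d - e) (d' - e').
Proof. by move=> h1 h2; apply: isWD => //; exact: isWN. Qed.

Lemma isWM a f g x d d' e e' : isW a f x d d' -> isW a g x e e' ->
  isW a (fun y => f y * g y) x (d * g x + f x * e) (d' * g x + f x * e').
Proof.
move=> [h1 h2] [h3 h4]; split.
  by apply: (isdC_eq (isdCM h1 h3)); rewrite line0; ring.
by apply: (isdC_eq (isdCM h2 h4)); rewrite line0; ring.
Qed.

Lemma isWZ a f x (c : C) d d' : isW a f x d d' ->
  isW a (fun y => c * f y) x (c * d) (c * d').
Proof. by move=> h; apply: (isW_eq (isWM (isW_cst a c x) h)); ring. Qed.

Lemma isWJ a f x d d' : isW a f x d d' -> isW a (fun y => (f y)^*) x (d'^*) (d^*).
Proof.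
move=> [h1 h2]; split.
  by apply: (isdC_eq (isdCJ h1)); rewrite rmorphD addrC.
by apply: (isdC_eq (isdCJ h2)); rewrite !conjE; ring.
Qed.

Lemma isWV a f x d d' : f x != 0 -> isW a f x d d' ->
  isW a (fun y => (f y)^-1) x (- (f x) ^- 2 * d) (- (f x) ^- 2 * d').
Proof.
move=> f0 [h1 h2]; split.
  by apply: (isdC_eq (isdCV _ h1)); rewrite line0 ?mulrDr.
by apply: (isdC_eq (isdCV _ h2)); rewrite line0// mulrCA mulrBr.
Qed.

Lemma isW_sum a (I : Type) (r : seq I) (f : I -> V -> C) x (d d' : I -> C) :
  (forall i, isW a (f i) x (d i) (d' i)) ->
  isW a (fun y => \sum_(i <- r) f i y) x (\sum_(i <- r) d i) (\sum_(i <- r) d' i).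
Proof.
move=> h; elim: r => [|i r IH].
  by rewrite !big_nil; under eq_fun do rewrite big_nil; exact: isW_cst.
by rewrite !big_cons; under eq_fun do rewrite big_cons; exact: isWD.
Qed.

Lemma isW_coord a b x : isW a (fun y => y 0 b) x (b == a)%:R 0.
Proof.
have h (c : C) : isdC (fun t => (x + ofR t *: (c *: stdb R a)) 0 b) (c * (b == a)%:R).
  have h1 : isdC (@ofR R) 1.
    split => /=; first exact: is_derive_id.
    exact: isd_cst.
  have e : (fun t : R => (x + ofR t *: (c *: stdb R a)) 0 b) =
           (fun t => x 0 b + ofR t * (c * (b == a)%:R)).
    by apply/funext => t; rewrite !mxE.
  rewrite e; apply: (isdC_eq (isdCD (isdC_cst _) (isdCM h1 (isdC_cst _)))).
  by ring.
split; last by apply: (isdC_eq (h _)); ring.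
have := h 1; rewrite scale1r => h1; apply: (isdC_eq h1); by ring.
Qed.

Lemma isW_uniq a f x d d' e e' : isW a f x d d' -> isW a f x e e' ->
  d = e /\ d' = e'.
Proof.
move=> h1 h2; split; first by rewrite -(isW_dz h1) (isW_dz h2).
by rewrite -(isW_dzb h1) (isW_dzb h2).
Qed.

Lemma isW_ln a (u : V -> R) x d d' : u x != 0 ->
  isW a (fun y => ofR (u y)) x d d' ->
  isW a (fun y => ofR (ln `|u y|)) x (d / ofR (u x)) (d' / ofR (u x)).
Proof.
move=> ux h.
have hv v e : isdC (fun t => ofR (u (x + ofR t *: v))) e ->
    isdC (fun t => ofR (ln `|u (x + ofR t *: v)|)) (e / ofR (u x)).
  (* As [u] is real valued, its derivative along a real line has imaginary part 0. *)
  move=> [h1 h2]; have := isd_uniq h2 (isd_cst 0) => e0.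
  split.
    apply: (isd_eq (isd_ln_norm _ h1)); rewrite line0//.
    by rewrite -ofRV !ReImE e0; ring.
  apply: (isd_eq (isd_cst 0)).
  by rewrite -ofRV !ReImE e0; ring.
move: h => [/hv h1 /hv h2]; split.
  by apply: (isdC_eq h1); rewrite mulrDl.
by apply: (isdC_eq h2); rewrite -mulrA mulrBl.
Qed.

(** Differentiability without a value. For the inverse metric existence is enough, since its
    contribution is later found by implicit differentiation. *)
Definition isWd a f x : Prop := exists d d', isW a f x d d'.

Lemma isWd_sum a (I : Type) (r : seq I) (P : pred I) (f : I -> V -> C) x :
  (forall i, isWd a (f i) x) -> isWd a (fun y => \sum_(i <- r | P i) f i y) x.
Proof.
move=> h; elim: r => [|i r [d [d' IH]]].
  by under eq_fun do rewrite big_nil; exists 0, 0; exact: isW_cst.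
under eq_fun do rewrite big_cons; case: (P i); last by exists d, d'.
by have [e [e' h']] := h i; exists (e + d), (e' + d'); exact: isWD.
Qed.

Lemma isWd_M a f g x : isWd a f x -> isWd a g x -> isWd a (fun y => f y * g y) x.
Proof. by move=> [? [? h1]] [? [? h2]]; do 2 eexists; exact: isWM h1 h2. Qed.

Lemma isWd_prod a (I : Type) (r : seq I) (P : pred I) (f : I -> V -> C) x :
  (forall i, isWd a (f i) x) -> isWd a (fun y => \prod_(i <- r | P i) f i y) x.
Proof.
move=> h; elim: r => [|i r IH].
  by under eq_fun do rewrite big_nil; exists 0, 0; exact: isW_cst.
by under eq_fun do rewrite big_cons; case: (P i) => //; exact: isWd_M.
Qed.

Lemma isWd_cst a c x : isWd a (fun=> c) x.
Proof. by exists 0, 0; exact: isW_cst. Qed.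

Lemma isWd_det a p (A : V -> 'M[C]_p) x :
  (forall i j, isWd a (fun y => A y i j) x) -> isWd a (fun y => \det (A y)) x.
Proof.
move=> h; rewrite /determinant.
apply: (@isWd_sum _ _ _ _ (fun s y => (-1) ^+ _ * \prod_i A y i (_ s i))) => s.
apply: isWd_M; first exact: isWd_cst.
by apply: (@isWd_prod _ _ _ _ (fun i y => A y i _)).
Qed.

(** Cramer's rule: the entries are cofactors divided by the determinant. Invertibility is required
    near [x] because [invmx] returns a singular matrix unchanged. *)
Lemma isWd_invmx a p (A : V -> 'M[C]_p) x (i j : 'I_p) :
  (forall i j, isWd a (fun y => A y i j) x) ->
  (\forall y \near x, A y \in unitmx) ->
  isWd a (fun y => invmx (A y) i j) x.
Proof.
move=> h uA.
have [d [d' hd]] := isWd_det h.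
have d0 : \det (A x) != 0 by rewrite -unitfE -unitmxE; exact: nbhs_singleton uA.
have [e [e' he]] : isWd a (fun y => cofactor (A y) j i) x.
  rewrite /cofactor; apply: isWd_M; first exact: isWd_cst.
  apply: isWd_det => k l; have := h (lift j k) (lift i l).
  by under [X in _ -> isWd _ X _]eq_fun do rewrite !mxE.
have hp := isWM (isWV d0 hd) he; do 2 eexists.
apply: isW_near hp; apply: filterS uA => y uAy.
by rewrite /invmx uAy !mxE.
Qed.

End Wirtinger.
End ComplexLines.

(** * Holomorphic functions: Cauchy-Riemann equations, higher derivatives, Euler's identity *)

Section Holomorphic.
Variables (R : realType) (m : nat).
Local Notation C := (Cx R).
Local Notation Re := (@complex.Re R).
Local Notation Im := (@complex.Im R).
Local Notation V := 'rV[C]_m.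
Local Notation isd g d := (is_derive (0 : R) (1 : R) (g : R -> R) (d : R)).
Variable U : set V.
Implicit Types F : V -> C.
Hypothesis oU : open U.

(** As [U] is open, agreement on [U] is agreement near each of its points. It is needed because
    [dz a F] equals a real directional derivative of [F] only on [U]. *)
Lemma Ck_eq k (f g : V -> R) : (forall x, U x -> f x = g x) ->
  Ck k U f -> Ck k U g.
Proof.
have near_eq (f1 g1 : V -> R) x : (forall y, U y -> f1 y = g1 y) -> U x ->
    \forall y \near x, f1 y = g1 y.
  by move=> fg Ux; apply: filterS (open_nbhs_nbhs (conj oU Ux)) => y /fg.
have cont_eq (f1 g1 : V -> R) : (forall y, U y -> f1 y = g1 y) ->
    (forall x, U x -> {for x, continuous f1}) ->
    forall x, U x -> {for x, continuous g1}.
  move=> fg fc x Ux; have h : f1 y @[y --> x] --> f1 x := fc x Ux.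
  suff : g1 y @[y --> x] --> g1 x by [].
  rewrite -(fg x Ux); apply: cvg_trans h.
  by apply: (@near_eq_cvg _ _ (nbhs x)); exact: near_eq.
elim: k f g => [|k IH] f g fg [fc fd]; split=> //.
- exact: cont_eq fc.
- exact: cont_eq fc.
- move=> v; have [h1 h2] := fd v; split.
    move=> x Ux; apply: (near_eq_derivable (f := fun t : R => f (x + ofR t *: v))).
      exact: (line_near v (near_eq _ _ _ fg Ux)).
    exact: h1.
  apply: IH h2 => x Ux; apply: dirR_near; exact: near_eq.
Qed.

Lemma smoothC_isdC F v x : smoothC U F -> U x ->
  isdC (fun t => F (x + ofR t *: v)) (dirC F v x).
Proof. by move=> [h1 h2] Ux; split; [exact: smooth_isd h1 Ux|exact: smooth_isd h2 Ux]. Qed.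

Lemma smoothC_dirC F v : smoothC U F -> smoothC U (dirC F v).
Proof. by move=> [h1 h2]; split; exact: smooth_dirR. Qed.

Lemma dirC_comm F u v x : smoothC U F -> U x ->
  dirC (dirC F u) v x = dirC (dirC F v) u x.
Proof.
move=> [h1 h2] Ux; apply: CxP; rewrite /dirC /=.
  exact: (dirR_comm _ _ oU Ux (h1 2)).
exact: (dirR_comm _ _ oU Ux (h2 2)).
Qed.

Lemma dirC_dirD F u v x : smoothC U F -> U x ->
  dirC F (u + v) x = dirC F u x + dirC F v x.
Proof.
move=> [h1 h2] Ux; apply: isdC_dir; split; rewrite ReImE.
  exact: (isd_dirD _ _ oU Ux (h1 1)).
exact: (isd_dirD _ _ oU Ux (h2 1)).
Qed.

Lemma dirC_dirZ F (a : R) v x : smoothC U F -> U x ->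
  dirC F (ofR a *: v) x = ofR a * dirC F v x.
Proof.
move=> [h1 h2] Ux; apply: isdC_dir; split; rewrite !ReImE mul0r ?subr0 ?addr0.
  exact: (isd_dirZ _ _ Ux (h1 1)).
exact: (isd_dirZ _ _ Ux (h2 1)).
Qed.

Lemma dirC_near (F G : V -> C) v x : (\forall y \near x, F y = G y) -> dirC F v x = dirC G v x.
Proof.
by move=> FG; apply: CxP; rewrite /dirC /=; apply: dirR_near;
  apply: filterS FG => y ->.
Qed.

Lemma hol_CR F a x : holomorphic U F -> U x ->
  dirC F (imI R *: stdb R a) x = imI R * dirC F (stdb R a) x.
Proof.
move=> [_ /(_ x)h] Ux; have /eqP := h Ux a; rewrite /dzb mulf_eq0 invr_eq0 pnatr_eq0/=.
rewrite addr_eq0 => /eqP ->; rewrite mulrN mulrA imI2.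
by rewrite mulN1r opprK.
Qed.

Lemma hol_dz F a x : holomorphic U F -> U x -> dz a F x = dirC F (stdb R a) x.
Proof.
by move=> hF Ux; rewrite /dz hol_CR// mulrA imI2; field.
Qed.

Lemma hol_isW F a x : holomorphic U F -> U x -> isW a F x (dz a F x) 0.
Proof.
move=> hF Ux; split; apply: isdC_eq (smoothC_isdC _ hF.1 Ux) _.
  by rewrite hol_dz ?addr0.
by rewrite hol_CR// hol_dz ?subr0.
Qed.

(** Real linearity in the direction and the Cauchy-Riemann equation together give complex
    linearity. *)
Lemma hol_dirZ F a (c : C) x : holomorphic U F -> U x ->
  dirC F (c *: stdb R a) x = c * dz a F x.
Proof.
move=> hF Ux; have sF := hF.1; rewrite [in LHS](ReImC c) scalerDl mulrC -scalerA mulrC.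
rewrite dirC_dirD// dirC_dirZ// [_ *: (_ *: _)]scalerA mulrC -scalerA dirC_dirZ//.
by rewrite hol_CR// hol_dz// [in RHS](ReImC c); ring.
Qed.

Lemma hol_isdC F v x : holomorphic U F -> U x ->
  isdC (fun t => F (x + ofR t *: v)) (\sum_a v 0 a * dz a F x).
Proof.
move=> hF Ux; have sF := hF.1.
suff <- : dirC F v x = \sum_a v 0 a * dz a F x by exact: smoothC_isdC.
rewrite [in LHS](row_sum_delta v).
elim: index_enum => [|a r IH]; last by rewrite !big_cons dirC_dirD// IH hol_dirZ.
by rewrite !big_nil -(scale0r 0) -ofR0 dirC_dirZ// ofR0 mul0r.
Qed.

(** On [U] the function [dz a F] is the derivative of [F] along a real direction, hence smooth. Its
    Cauchy-Riemann equation is that of [F], differentiated after exchanging the two derivatives. *)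
Lemma hol_dz_hol F a : holomorphic U F -> holomorphic U (dz a F).
Proof.
move=> hF; have [sF _] := hF; split.
  have [s1 s2] := smoothC_dirC (stdb R a) sF.
  have eqU x : U x -> dirC F (stdb R a) x = dz a F x by move=> Ux; rewrite hol_dz.
  by split=> k; [apply: Ck_eq (s1 k)|apply: Ck_eq (s2 k)] => x /eqU ->.
move=> x Ux b; have nx : \forall y \near x, U y by exact: open_nbhs_nbhs.
have e v : dirC (dz a F) v x = dirC (dirC F (stdb R a)) v x.
  by apply: dirC_near; apply: filterS nx => y Uy; exact: hol_dz.
have alg (A B : C) : B = imI R * A -> 2^-1 * (A + imI R * B) = 0.
  by move=> ->; rewrite mulrA imI2 mulN1r subrr mulr0.
apply: alg; apply: etrans (e _) _; apply: etrans _ (congr1 _ (esym (e _))).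
apply: etrans (dirC_comm _ _ sF Ux) _.
apply: etrans _ (congr1 _ (dirC_comm _ _ sF Ux)).
apply: (@etrans _ _ (dirC (fun y => imI R * dirC F (stdb R b) y) (stdb R a) x)).
  by apply: dirC_near; apply: filterS nx => y Uy; exact: hol_CR.
apply: isdC_dir; apply: isdC_eq (isdCM (isdC_cst (imI R))
  (smoothC_isdC (stdb R a) (smoothC_dirC (stdb R b) sF) Ux)) _.
by rewrite mul0r add0r.
Qed.

Lemma hol_dz_comm F a b x : holomorphic U F -> U x ->
  dz a (dz b F) x = dz b (dz a F) x.
Proof.
move=> hF Ux; have [sF _] := hF; have nx : \forall y \near x, U y by exact: open_nbhs_nbhs.
have e c d : dz c (dz d F) x = dirC (dirC F (stdb R d)) (stdb R c) x.
  rewrite (hol_dz c (hol_dz_hol d hF) Ux).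
  by apply: dirC_near; apply: filterS nx => y Uy; exact: hol_dz.
by apply: etrans (e _ _) _; apply: etrans _ (esym (e _ _)); exact: dirC_comm.
Qed.

Lemma hol_continuous F x : holomorphic U F -> U x -> {for x, continuous F}.
Proof.
move=> [[h1 h2] _] Ux.
have -> : F = (fun y => ofR (Re (F y)) + imI R * ofR (Im (F y))).
  by apply/funext => y; exact: ReImC.
have c (f : V -> R) : {for x, continuous f} -> {for x, continuous (fun y => ofR (f y))}.
  by move=> fc; apply: continuous_comp fc _; exact: ofR_continuous.
suff : (ofR (Re (F y)) + imI R * ofR (Im (F y))) @[y --> x]
    --> ofR (Re (F x)) + imI R * ofR (Im (F x)) by [].
apply: (@cvgD C C^o V (nbhs x) _ (fun y => ofR (Re (F y))));
  first by apply: c; exact: smooth_continuous h1 Ux.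
apply: (@cvgM C V (nbhs x) _ (fun=> imI R)); first exact: cvg_cst.
by apply: c; exact: smooth_continuous h2 Ux.
Qed.

(** Both sides are the derivative at [t = 0] of [F ((1 + t) x) = (1 + t)^2 F x]. *)
Lemma hol_euler F x : holomorphic U F -> U x ->
  (forall (l : C) eta, l != 0 -> U eta -> F (l *: eta) = l ^+ 2 * F eta) ->
  \sum_a x 0 a * dz a F x = 2 * F x.
Proof.
move=> hF Ux hom; have h := hol_isdC x hF Ux; apply: (isdC_uniq h).
have h1 : isdC (@ofR R) 1.
  by split => /=; [exact: is_derive_id|exact: isd_cst].
have h2 : isdC (fun t => 1 + ofR t) (0 + 1) := isdCD (isdC_cst 1) h1.
apply: (@isdC_near _ (fun t => (1 + ofR t) * (1 + ofR t) * F x)).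
  near=> t; rewrite -expr2 -hom//; first by rewrite scalerDl scale1r.
  have : `|t| < 1 by near: t; apply: (@nbhs0_lt _ R^o).
  rewrite -ofR1 -ofRD ofR_eq0 ltr_norml => /andP[t1 _].
  by rewrite gt_eqF// -ltrBlDl sub0r.
apply: isdC_eq (isdCM (isdCM h2 h2) (isdC_cst (F x))) _.
by rewrite ofR0; ring.
Unshelve. all: by end_near. Qed.

End Holomorphic.
(** * Curvature in affine coordinates *)

Section SpecialGeometry.
Variables (R : realType) (n : nat).
Local Notation C := (Cx R).
Local Notation V := 'rV[C]_n.
Local Notation i_ := (imI R).
Variables (W : set V) (f : V -> C) (f1 : 'I_n -> V -> C) (f2 : 'I_n -> 'I_n -> V -> C)
  (f3 : 'I_n -> 'I_n -> 'I_n -> V -> C).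
Hypothesis oW : open W.
Hypothesis Hf : forall w i, W w -> isW i f w (f1 i w) 0.
Hypothesis Hf1 : forall w i j, W w -> isW i (f1 j) w (f2 i j w) 0.
Hypothesis Hf2 : forall w i j k, W w -> isW i (f2 j k) w (f3 i j k w) 0.
Hypothesis Hf3 : forall w l i j k, W w -> exists d, isW l (f3 i j k) w d 0.
Hypothesis f2C : forall w i j, W w -> f2 i j w = f2 j i w.
Hypothesis f3C : forall w i j k, W w -> f3 i j k w = f3 j i k w.

Lemma near_W w : W w -> \forall w' \near w, W w'.
Proof. by move=> Ww; exact: open_nbhs_nbhs. Qed.

(** Differentiating the symmetry of [f2], valid on the open set [W]. Together with [f3C] it makes
    [f3] totally symmetric. *)
Lemma f3Cr w i j k : W w -> f3 i j k w = f3 i k j w.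
Proof.
move=> Ww; have h := Hf2 i k j Ww.
have h' : isW i (f2 k j) w (f3 i j k w) 0.
  by apply: isW_near (Hf2 i j k Ww); apply: filterS (near_W Ww) => w'; exact: f2C.
by have [] := isW_uniq h' h.
Qed.

Lemma sum_delta (i : 'I_n) (g : 'I_n -> C) : \sum_m (m == i)%:R * g m = g i.
Proof.
rewrite (bigD1 i)//= eqxx mul1r big1 ?addr0// => j /negPf ->.
by rewrite mul0r.
Qed.

(* [k1], [k2] and [k11] are the derivatives d_i k, d_i d_j k and d_i dbar_j k of
   the affine potential [kf]; [imx] is z - conj z. *)
Definition imx (m : 'I_n) (w : V) : C := w 0 m - (w 0 m)^*.
Definition kf (w : V) : C :=
  - i_ * (2 * (f w - (f w)^*) - \sum_m imx m w * (f1 m w + (f1 m w)^*)).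
Definition k1 i w : C :=
  - i_ * (f1 i w - (f1 i w)^* - \sum_m imx m w * f2 i m w).
Definition k2 i j w : C := i_ * \sum_m imx m w * f3 i j m w.
Definition k11 i j w : C := - i_ * (f2 i j w - (f2 i j w)^*).

Lemma conj_imx m w : (imx m w)^* = - imx m w.
Proof. by rewrite /imx !conjE; ring. Qed.

Lemma conj_kf w : (kf w)^* = kf w.
Proof.
rewrite /kf !conjE (eq_bigr (fun m => - (imx m w * (f1 m w + (f1 m w)^*)))).
  by rewrite sumrN; ring.
by move=> m _; rewrite conjM conj_imx ?conjE; ring.
Qed.

Lemma conj_k11 i j w : (k11 i j w)^* = k11 i j w.
Proof. by rewrite /k11 !conjE; ring. Qed.

Lemma k11C i j w : W w -> k11 i j w = k11 j i w.
Proof. by move=> Ww; rewrite /k11 f2C. Qed.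

Lemma conj_k1 i w : (k1 i w)^* = - i_ * (f1 i w - (f1 i w)^* - \sum_m imx m w * (f2 i m w)^*).
Proof.
rewrite /k1 !conjE (eq_bigr (fun m => - (imx m w * (f2 i m w)^*))).
  by rewrite sumrN; ring.
by move=> m _; rewrite conjM conj_imx ?conjE; ring.
Qed.

Lemma isW_imx i m w : isW i (imx m) w (m == i)%:R (- (m == i)%:R).
Proof.
have h := isW_coord i m w.
by apply: isW_eq (isWB h (isWJ h)) _ _; rewrite ?conjE; ring.
Qed.

Lemma isW_kf i w : W w -> isW i kf w (k1 i w) ((k1 i w)^*).
Proof.
move=> Ww; have h m := Hf1 i m Ww.
have hs := isW_sum (index_enum _) (fun m => isWM (isW_imx i m w) (isWD (h m) (isWJ (h m)))).
apply: isW_eq (isWZ (- i_) (isWB (isWZ 2 (isWB (Hf i Ww) (isWJ (Hf i Ww)))) hs)) _ _.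
  rewrite big_split/= sum_delta /k1.
  rewrite (eq_bigr (fun m => imx m w * f2 i m w)).
    by rewrite ?conjE; ring.
  by move=> m _; rewrite ?conjE; ring.
rewrite big_split/= (eq_bigr (fun m => - ((m == i)%:R * (f1 m w + (f1 m w)^*)))).
  rewrite sumrN sum_delta conj_k1 (eq_bigr (fun m => imx m w * (f2 i m w)^*)).
    by rewrite ?conjE; ring.
  by move=> m _; ring.
by move=> m _; ring.
Qed.

(** In the holomorphic derivative the second derivatives of [f] cancel against the derivative of
    [imx], so that [k2] contains third derivatives only. *)
Lemma isW_k1 l i w : W w -> isW l (k1 i) w (k2 l i w) (k11 i l w).
Proof.
move=> Ww; have h m := Hf2 l i m Ww.
have hs := isW_sum (index_enum _) (fun m => isWM (isW_imx l m w) (h m)).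
apply: isW_eq (isWZ (- i_) (isWB (isWB (Hf1 l i Ww) (isWJ (Hf1 l i Ww))) hs)) _ _.
  rewrite big_split/= sum_delta /k2 (f2C l i Ww).
  by rewrite ?conjE; ring.
rewrite big_split/= (eq_bigr (fun m => - ((m == l)%:R * f2 i m w))).
  rewrite sumrN sum_delta big1; last by move=> m _; ring.
  by rewrite /k11 (f2C l i Ww); ring.
by move=> m _; ring.
Qed.

Lemma isW_k11 l i j w : W w ->
  isW l (k11 i j) w (- i_ * f3 l i j w) (i_ * (f3 l i j w)^*).
Proof.
move=> Ww; have h := Hf2 l i j Ww.
by apply: isW_eq (isWZ (- i_) (isWB h (isWJ h))) _ _; rewrite ?conjE; ring.
Qed.

Hypothesis kf_neq0 : forall w, W w -> kf w != 0.

(* [th], [hm], [Bm] and, below, [hi] and [Xf] are theta, h, B, the inverse of h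
   (with hi j m = h^{j bar m}) and X; [dh l i j] is d_l h_{ij}. *)
Definition th i w : C := k1 i w / kf w.
Definition hm i j w : C := k11 i j w / kf w - th i w * (th j w)^*.
Definition Bm p m w : C := (p == m)%:R + imx p w * (th m w)^*.
Definition dh l i j w : C :=
  - (hm i j w * th l w + hm l j w * th i w)
  - i_ / kf w * \sum_p f3 l i p w * Bm p j w.

Lemma conj_hm i j w : W w -> (hm i j w)^* = hm j i w.
Proof.
move=> Ww; rewrite /hm conjD conjN conj_div conj_mulJ conj_kf conj_k11 (k11C _ _ Ww).
by rewrite [_ * th j w]mulrC.
Qed.

Lemma isW_th l i w : W w ->
  isW l (th i) w (k2 l i w / kf w - th l w * th i w) (hm i l w).
Proof.
move=> Ww; have k0 := kf_neq0 Ww.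
apply: isW_eq (isWM (isW_k1 l i Ww) (isWV k0 (isW_kf l Ww))) _ _.
  by rewrite /th; field.
by rewrite /hm /th conj_div conj_kf; field.
Qed.

Lemma isW_hm l i j w : W w -> isW l (hm i j) w (dh l i j w) ((dh l j i w)^*).
Proof.
move=> Ww.
(* Only the holomorphic derivative is computed. The antiholomorphic one is then the conjugate of the
   holomorphic derivative of [hm j i], because h is hermitian. *)
have holo i' j' w' : W w' -> exists d', isW l (hm i' j') w' (dh l i' j' w') d'.
  move=> Ww'; have k0 := kf_neq0 Ww'; eexists.
  apply: isW_eq (isWB (isWM (isW_k11 l i' j' Ww') (isWV k0 (isW_kf l Ww')))
    (isWM (isW_th l i' Ww') (isWJ (isW_th l j' Ww')))) _ (erefl _).
  rewrite conj_hm// /dh.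
  have -> : \sum_p f3 l i' p w' * Bm p j' w' =
      f3 l i' j' w' + (\sum_p imx p w' * f3 l i' p w') * (th j' w')^*.
    rewrite -[f3 _ _ j' _](sum_delta j' (fun p => f3 l i' p w')) mulr_suml -big_split/=.
    by apply: eq_bigr => p _; rewrite /Bm; ring.
  rewrite /k2; move: (\sum_p _) => S.
  by rewrite /hm /th conj_div conj_kf; field.
have [d' hd] := holo i j w Ww; have [e' he] := holo j i w Ww.
have he' : isW l (hm i j) w (e'^*) ((dh l j i w)^*).
  apply: isW_near (isWJ he); apply: filterS (near_W Ww) => w' Ww'; exact: conj_hm.
by have [_ <-] := isW_uniq hd he'.
Qed.

Lemma conj_Bm q j w : (Bm q j w)^* = (q == j)%:R - imx q w * th j w.
Proof. by rewrite /Bm conjD conj_mulJ conj_imx conj_nat; ring. Qed.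

(** * The inverse metric and the quadratic identity for B *)

Hypothesis hm_unit : forall w, W w -> \matrix_(i, j) hm i j w \in unitmx.

Definition hi j m w : C := invmx (\matrix_(i, k) hm i k w) m j.

Lemma hm_hi k j w : W w -> \sum_m hm k m w * hi j m w = (k == j)%:R.
Proof.
move=> Ww; have /matrixP/(_ k j) := mulmxV (hm_unit Ww); rewrite !mxE => <-.
by apply: eq_bigr => m _; rewrite !mxE.
Qed.

Lemma hi_hm m m' w : W w -> \sum_j hi j m w * hm j m' w = (m == m')%:R.
Proof.
move=> Ww; have /matrixP/(_ m m') := mulVmx (hm_unit Ww); rewrite !mxE => <-.
by apply: eq_bigr => j _; rewrite !mxE.
Qed.

Lemma sum_delta' (i : 'I_n) (g : 'I_n -> C) : \sum_m (i == m)%:R * g m = g i.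
Proof. by under eq_bigr do rewrite eq_sym; exact: sum_delta. Qed.

Lemma sum_delta_r (i : 'I_n) (g : 'I_n -> C) : \sum_m g m * (m == i)%:R = g i.
Proof. by under eq_bigr do rewrite mulrC; exact: sum_delta. Qed.

Definition bth w : C := \sum_m imx m w * (th m w)^*.

(** [k1] and its conjugate differ only in having [f2] or its conjugate contracted with [imx]; hence
    contracting [k11] with [imx] gives their difference. *)
Lemma hm_imx r w : W w ->
  \sum_q hm r q w * imx q w = (th r w)^* - (1 + bth w) * th r w.
Proof.
move=> Ww; have k0 := kf_neq0 Ww.
have e : \sum_q k11 r q w * imx q w = (k1 r w)^* - k1 r w.
  rewrite conj_k1 /k1 (eq_bigr (fun q => - i_ * (imx q w * f2 r q w) + i_ * (imx q w * (f2 r q w)^*))).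
    by rewrite big_split/= -!mulr_sumr; ring.
  by move=> q _; rewrite /k11; ring.
rewrite (eq_bigr (fun q => (kf w)^-1 * (k11 r q w * imx q w) + - th r w * (imx q w * (th q w)^*))).
  rewrite big_split/= -!mulr_sumr e /th conj_div conj_kf -/(bth w).
  by field.
by move=> q _; rewrite /hm; ring.
Qed.

(** [k11] is symmetric, so the antisymmetric part of h comes from the product of [th] and its
    conjugate alone. *)
Lemma hm_asym r j w : W w ->
  hm r j w = hm j r w - th r w * (th j w)^* + th j w * (th r w)^*.
Proof. by move=> Ww; rewrite /hm (k11C _ _ Ww); ring. Qed.

(* Both sides are compared after contraction with h_{rq}. *)
Lemma hi_BB p q w : W w ->
  \sum_j \sum_m hi j m w * Bm p m w * (Bm q j w)^* = hi p q w + imx p w * imx q w.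
Proof.
move=> Ww.
pose D q := \sum_j \sum_m hi j m w * Bm p m w * (Bm q j w)^* - (hi p q w + imx p w * imx q w).
(* Since h is invertible, a vector that h contracts to zero vanishes. *)
suff D0 r : \sum_q D q * hm r q w = 0.
  apply/eqP; rewrite -subr_eq0 -/(D q) -(sum_delta_r q D); apply/eqP.
  transitivity (\sum_s \sum_r hi r q w * (D s * hm r s w)).
    apply: eq_bigr => s _; rewrite eq_sym -(hi_hm q s Ww) mulr_sumr.
    by apply: eq_bigr => r _; ring.
  rewrite exchange_big/= big1// => r _.
  by rewrite -mulr_sumr D0 mulr0.
(* Using [hm_imx] at [r] and at [j] and the antisymmetric part of h, the index [j] is moved to the
   first slot of h, where [hi] contracts it to a Kronecker delta. *)
have Bh j : \sum_q (Bm q j w)^* * hm r q w =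
    hm j r w - th r w * \sum_m hm j m w * imx m w.
  rewrite (eq_bigr (fun q => (q == j)%:R * hm r q w + - th j w * (hm r q w * imx q w))).
    rewrite big_split/= sum_delta -mulr_sumr !hm_imx// (hm_asym r j Ww).
    by ring.
  by move=> s _; rewrite conj_Bm; ring.
have L : \sum_q (\sum_j \sum_m hi j m w * Bm p m w * (Bm q j w)^*) * hm r q w =
    Bm p r w - th r w * (imx p w + imx p w * bth w).
  transitivity (\sum_m Bm p m w * \sum_j hi j m w * \sum_q (Bm q j w)^* * hm r q w).
    under eq_bigr do rewrite mulr_suml.
    rewrite exchange_big/=.
    transitivity (\sum_j \sum_m \sum_q Bm p m w * (hi j m w * ((Bm q j w)^* * hm r q w))).
      apply: eq_bigr => j _; under eq_bigr do rewrite mulr_suml.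
      rewrite exchange_big/=; apply: eq_bigr => m _; apply: eq_bigr => s _; ring.
    rewrite exchange_big/=; apply: eq_bigr => m _; rewrite mulr_sumr.
    by apply: eq_bigr => j _; rewrite !mulr_sumr.
  (* The inner contraction with [hi] turns both terms of [Bh] into deltas. *)
  transitivity (\sum_m Bm p m w * ((m == r)%:R - th r w * imx m w)).
    apply: eq_bigr => m _; congr (_ * _); rewrite -(hi_hm m r Ww).
    rewrite -(sum_delta' m (fun m => imx m w)) mulr_sumr -sumrB.
    transitivity (\sum_j (hi j m w * hm j r w - th r w * \sum_s hi j m w * hm j s w * imx s w)).
      apply: eq_bigr => j _; rewrite Bh mulrBr; congr (_ - _).
      by rewrite mulrCA; congr (_ * _); rewrite mulr_sumr; apply: eq_bigr => s _; ring.
    rewrite !sumrB; congr (_ - _); rewrite -mulr_sumr exchange_big/= mulr_sumr.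
    apply: eq_bigr => s _; rewrite -(hi_hm m s Ww) mulr_suml.
    by [].
  rewrite (eq_bigr (fun m => Bm p m w * (m == r)%:R +
     - th r w * ((m == p)%:R * imx m w + imx p w * (imx m w * (th m w)^*)))).
    rewrite big_split/= sum_delta_r -mulr_sumr big_split/= sum_delta -mulr_sumr -/(bth w).
    by ring.
  by move=> m _; rewrite mulrBr [in X in _ - X]/Bm [p == m]eq_sym; ring.
transitivity (\sum_q ((\sum_j \sum_m hi j m w * Bm p m w * (Bm q j w)^*) * hm r q w
   - (hm r q w * hi p q w) - imx p w * (hm r q w * imx q w))).
  by apply: eq_bigr => s _; rewrite /D; ring.
rewrite !sumrB L hm_hi// -mulr_sumr hm_imx// /Bm eq_sym.
by ring.
Qed.

(** * Christoffel symbols and their antiholomorphic derivatives *)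

Definition Xf j p w : C := (\sum_m hi j m w * Bm p m w) / kf w.
Definition Gam j i k w : C := \sum_m hi j m w * dh i k m w.

(** The two terms of [dh] that contain [hm] contract with [hi] to Kronecker deltas; the remaining
    term is the contraction of [f3] with [Xf]. *)
Lemma Gam_eq j i k w : W w -> Gam j i k w =
  - ((j == k)%:R * th i w + (i == j)%:R * th k w) - i_ * \sum_p f3 i k p w * Xf j p w.
Proof.
move=> Ww; rewrite /Gam.
rewrite (eq_bigr (fun m => - th i w * (hm k m w * hi j m w) - th k w * (hm i m w * hi j m w)
   - i_ * \sum_p f3 i k p w * (hi j m w * Bm p m w / kf w))).
  rewrite !sumrB -!mulr_sumr !hm_hi// exchange_big/=.
  rewrite (eq_bigr (fun p => f3 i k p w * Xf j p w)).
    by rewrite [k == j]eq_sym; ring.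
  by move=> p _; rewrite /Xf -mulr_sumr -mulr_suml.
move=> m _; rewrite /dh [in RHS](eq_bigr (fun p => hi j m w / kf w * (f3 i k p w * Bm p m w))).
  by rewrite -mulr_sumr; ring.
by move=> p _; ring.
Qed.

Lemma isWd_hi l j m w : W w -> isWd l (hi j m) w.
Proof.
move=> Ww; apply: isWd_invmx => [i k|].
  under eq_fun do rewrite mxE; do 2 eexists; exact: isW_hm.
by apply: filterS (near_W Ww) => w'; exact: hm_unit.
Qed.

Lemma isW_Bm l p m w : W w -> isW l (Bm p m) w
  ((p == l)%:R * (th m w)^* + imx p w * hm l m w)
  (- (p == l)%:R * (th m w)^* + imx p w * (k2 l m w / kf w - th l w * th m w)^*).
Proof.
move=> Ww.
apply: isW_eq (isWD (isW_cst l _ w) (isWM (isW_imx l p w) (isWJ (isW_th l m Ww)))) _ _.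
  by rewrite conj_hm// add0r.
by rewrite add0r.
Qed.

Lemma conj_k2 i j w : (k2 i j w)^* = i_ * \sum_m imx m w * (f3 i j m w)^*.
Proof.
rewrite /k2 conjM conj_imI conj_sum (eq_bigr (fun m => - (imx m w * (f3 i j m w)^*))).
  by rewrite sumrN; ring.
by move=> m _; rewrite conjM conj_imx; ring.
Qed.

(** Implicit differentiation of [Xf] contracted with [hm] being [Bm / kf]. This uses that [hi] is
    differentiable, but no formula for its derivative. *)
Lemma isW_Xf l j p w : W w -> exists d, isW l (Xf j p) w d
  (- i_ / kf w ^+ 2 * \sum_m \sum_q hi j m w * hi p q w * (f3 l m q w)^*).
Proof.
move=> Ww; have k0 := kf_neq0 Ww.
have dX j' : isWd l (Xf j' p) w.
  have hB : isWd l (fun w => \sum_m hi j' m w * Bm p m w) w.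
    apply: (@isWd_sum _ _ _ _ _ _ (fun m w => hi j' m w * Bm p m w)) => m.
    by apply: isWd_M; [exact: isWd_hi|do 2 eexists; exact: isW_Bm].
  by apply: isWd_M hB _; do 2 eexists; exact: isWV k0 (isW_kf l Ww).
pose d' j' := dzb l (Xf j' p) w.
have hX j' : isW l (Xf j' p) w (dz l (Xf j' p) w) (d' j').
  by have [e [e' he]] := dX j'; rewrite /d' (isW_dz he) (isW_dzb he).
have Xh m w' : W w' -> \sum_j' Xf j' p w' * hm j' m w' = Bm p m w' / kf w'.
  move=> Ww'.
  transitivity (\sum_j' \sum_s (hi j' s w' * hm j' m w') * (Bm p s w' / kf w')).
    by apply: eq_bigr => j' _; rewrite /Xf !mulr_suml; apply: eq_bigr => s _; ring.
  rewrite exchange_big/= -(sum_delta m (fun s => Bm p s w' / kf w')).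
  by apply: eq_bigr => s _; rewrite -mulr_suml hi_hm.
(* The antiholomorphic derivatives of the two sides of [Xh]. *)
have E m : \sum_j' (d' j' * hm j' m w + Xf j' p w * (dh l m j' w)^*) =
    (- (p == l)%:R * (th m w)^* + imx p w * (k2 l m w / kf w - th l w * th m w)^*) / kf w
    - Bm p m w * (th l w)^* / kf w.
  have h1 := isW_sum (index_enum _) (fun j' => isWM (hX j') (isW_hm l j' m Ww)).
  have h2 := isWM (isW_Bm l p m Ww) (isWV k0 (isW_kf l Ww)).
  have h3 := isW_near _ h1; have [|_ ->] := isW_uniq (h3 _ _) h2.
    by apply: filterS (near_W Ww) => w'; exact: Xh.
  rewrite [(th l w)^*]conj_div conj_kf.
  move: ((k2 l m w / kf w - th l w * th m w)^*) => Z.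
  by field.
(* The terms in [th] cancel by the definition of [Bm]. Of the two terms of [hi_BB], the one
   quadratic in [imx] cancels against the conjugate of [k2], and the one in [hi] remains. *)
have F m : \sum_j' d' j' * hm j' m w = - i_ / kf w ^+ 2 * \sum_q hi p q w * (f3 l m q w)^*.
  have Y q : \sum_j' Xf j' p w * (Bm q j' w)^* = (hi p q w + imx p w * imx q w) / kf w.
    rewrite -hi_BB// mulr_suml; apply: eq_bigr => j' _; rewrite /Xf !mulr_suml.
    by apply: eq_bigr => s _; ring.
  have cdh j' : (dh l m j' w)^* = - (hm j' m w * (th l w)^* + hm j' l w * (th m w)^*)
      + i_ / kf w * \sum_q (f3 l m q w)^* * (Bm q j' w)^*.
    rewrite /dh conjD !conjN conjD conjM conj_hm// conjM conj_hm//.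
    rewrite [(i_ / _ * _)^*]conjM conj_div conj_imI conj_kf conj_sum.
    rewrite (eq_bigr (fun q => (f3 l m q w)^* * (Bm q j' w)^*)); first by ring.
    by move=> q _; exact: conjM.
  have S : \sum_j' Xf j' p w * (dh l m j' w)^* =
      - (Bm p m w / kf w * (th l w)^* + Bm p l w / kf w * (th m w)^*)
      + i_ / kf w * \sum_q (f3 l m q w)^* * ((hi p q w + imx p w * imx q w) / kf w).
    transitivity (\sum_j' (- (th l w)^* * (Xf j' p w * hm j' m w)
        - (th m w)^* * (Xf j' p w * hm j' l w)
        + i_ / kf w * \sum_q (f3 l m q w)^* * (Xf j' p w * (Bm q j' w)^*))).
      apply: eq_bigr => j' _; rewrite cdh.
      have -> : \sum_q (f3 l m q w)^* * (Xf j' p w * (Bm q j' w)^*) =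
          Xf j' p w * \sum_q (f3 l m q w)^* * (Bm q j' w)^*.
        by rewrite mulr_sumr; apply: eq_bigr => q _; ring.
      by ring.
    rewrite big_split sumrB/= -!mulr_sumr !Xh// exchange_big/=.
    rewrite (eq_bigr (fun q => (f3 l m q w)^* * ((hi p q w + imx p w * imx q w) / kf w))).
      by ring.
    by move=> q _; rewrite -mulr_sumr Y.
  move: (E m); rewrite big_split/= S => /(canRL (addrK _)) ->.
  rewrite (eq_bigr (fun q => (kf w)^-1 * (hi p q w * (f3 l m q w)^*)
     + imx p w / kf w * (imx q w * (f3 l m q w)^*))); last by move=> q _; ring.
  rewrite big_split/= -!mulr_sumr.
  rewrite [(k2 _ _ _ / _ - _)^*]conjD conjN conj_div conj_k2 conj_kf [(th l w * _)^*]conjM.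
  move: (\sum_q _) (\sum_q _) => S1 S2; rewrite /Bm [(p == m)]/(p == m).
  by field.
exists (dz l (Xf j p) w); apply: isW_eq (hX j) (erefl _) _.
rewrite -(sum_delta j d').
(* Contraction with [hi] solves for the derivative itself. *)
transitivity (\sum_j' \sum_m (hm j' m w * hi j m w) * d' j').
  by apply: eq_bigr => j' _; rewrite -mulr_suml hm_hi.
rewrite exchange_big/= mulr_sumr; apply: eq_bigr => m _.
transitivity (hi j m w * \sum_j' d' j' * hm j' m w).
  by rewrite mulr_sumr; apply: eq_bigr => j' _; ring.
by rewrite F mulrCA; congr (_ * _); rewrite mulr_sumr; apply: eq_bigr => q _; ring.
Qed.

Lemma isW_Gam l j i k w : W w -> exists d, isW l (Gam j i k) w d
  (- ((j == k)%:R * hm i l w + (i == j)%:R * hm k l w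
      + kf w ^- 2 * \sum_j' \sum_p \sum_q hi j j' w * hi p q w * f3 p k i w * (f3 q j' l w)^*)).
Proof.
move=> Ww; have k0 := kf_neq0 Ww.
(* The derivatives are collected into functions of [p], as [isW_sum] expects; [dz] supplies the
   witnesses. *)
have [dX hX] : exists dX, forall p, isW l (Xf j p) w (dX p)
    (- i_ / kf w ^+ 2 * \sum_m \sum_q hi j m w * hi p q w * (f3 l m q w)^*).
  exists (fun p => dz l (Xf j p) w) => p; have [d hd] := isW_Xf l j p Ww.
  by rewrite (isW_dz hd).
have [d3 h3] : exists d3, forall p, isW l (f3 i k p) w (d3 p) 0.
  exists (fun p => dz l (f3 i k p) w) => p; have [d hd] := Hf3 l i k p Ww.
  by rewrite (isW_dz hd).
have hs := isW_sum (index_enum _) (fun p => isWM (h3 p) (hX p)).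
have h := isWB (isWN (isWD (isWZ (j == k)%:R (isW_th l i Ww))
  (isWZ (i == j)%:R (isW_th l k Ww)))) (isWZ i_ hs).
eexists; apply: (@isW_near _ _ _ _ _ _ _ _ _ (isW_eq h (erefl _) _)).
  by apply: filterS (near_W Ww) => w' Ww'; rewrite Gam_eq.
suff -> : \sum_p (0 * Xf j p w + f3 i k p w * (- i_ / kf w ^+ 2 *
      \sum_m \sum_q hi j m w * hi p q w * (f3 l m q w)^*)) =
    - i_ / kf w ^+ 2 *
      \sum_j' \sum_p \sum_q hi j j' w * hi p q w * f3 p k i w * (f3 q j' l w)^*.
  have -> : i_ * (- i_ / kf w ^+ 2 * \sum_j' \sum_p \sum_q
        hi j j' w * hi p q w * f3 p k i w * (f3 q j' l w)^*) =
      kf w ^- 2 * \sum_j' \sum_p \sum_q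
        hi j j' w * hi p q w * f3 p k i w * (f3 q j' l w)^*.
    by rewrite mulrA mulrA mulrN imI2 opprK mul1r.
  by rewrite !opprD.
rewrite exchange_big/= mulr_sumr; apply: eq_bigr => p _.
rewrite mul0r add0r mulrCA; congr (_ * _); rewrite mulr_sumr.
apply: eq_bigr => m _; rewrite mulr_sumr; apply: eq_bigr => q _.
have -> : f3 p k i w = f3 i k p w by rewrite f3Cr// f3C// f3Cr.
have -> : f3 q m l w = f3 l m q w by rewrite f3Cr// f3C// f3Cr.
by ring.
Qed.

Lemma dzb_Gam l j i k w : W w -> - dzb l (Gam j i k) w =
  kf w ^- 2 * (\sum_j' \sum_p \sum_q hi j j' w * hi p q w * f3 p k i w * (f3 q j' l w)^*)
  + (i == j)%:R * hm k l w + (j == k)%:R * hm i l w.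
Proof.
by move=> Ww; have [d hd] := isW_Gam l j i k Ww; rewrite (isW_dzb hd); ring.
Qed.

End SpecialGeometry.
Lemma conj_2Im (R : realType) (x : Cx R) :
  (- imI R * (x - x^*))^* = - imI R * (x - x^*).
Proof. by rewrite !conjE; ring. Qed.

Lemma Im_mulJ (R : realType) (x y : Cx R) : complex.Im (x * y^*) =
  complex.Im x * complex.Re y - complex.Re x * complex.Im y.
Proof. by rewrite !ReImE; ring. Qed.

(** * From the prepotential to affine coordinates *)

Section Prepotential.
Variables (R : realType) (m : nat).
Local Notation C := (Cx R).
Local Notation V := 'rV[C]_m.
Local Notation i_ := (imI R).
Variables (U : set V) (F : V -> C).
Hypothesis oU : open U.
Hypothesis hF : holomorphic U F.
Hypothesis Fhom : forall (l : C) eta, l != 0 -> U eta -> F (l *: eta) = l ^+ 2 * F eta.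

(* 2 Im (d^2 F / deta^a deta^b) *)
Definition Nmx (a b : 'I_m) (eta : V) : C :=
  - i_ * (dz a (dz b F) eta - (dz a (dz b F) eta)^*).

Lemma conj_Nmx a b eta : (Nmx a b eta)^* = Nmx a b eta.
Proof. exact: conj_2Im. Qed.

Lemma NmxC a b eta : U eta -> Nmx a b eta = Nmx b a eta.
Proof. by move=> Ue; rewrite /Nmx (hol_dz_comm oU). Qed.

(** The derivative of Euler's identity: the first derivatives of [F] are homogeneous of degree 1. *)
Lemma euler_dz a eta : U eta -> \sum_b eta 0 b * dz a (dz b F) eta = dz a F eta.
Proof.
move=> Ue; have nU : \forall x \near eta, U x by exact: open_nbhs_nbhs.
have h := isW_sum (index_enum _) (fun b => isWM (isW_coord a b eta)
  (hol_isW a (hol_dz_hol oU b hF) Ue)).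
have h2 := isWZ 2 (hol_isW a hF Ue).
have h3 := isW_near _ h; have [|+ _] := isW_uniq (h3 _ _) h2.
  by apply: filterS nU => x Ux; exact: (hol_euler oU hF Ux Fhom).
move=> e; apply: (addrI (dz a F eta)).
rewrite -[X in X + _](sum_delta a (fun b => dz b F eta)) -big_split.
apply: etrans e _.
by move: (dz a F eta) => G; ring.
Qed.

Lemma sum_Nmx a eta : U eta -> \sum_b Nmx a b eta * (eta 0 b)^* =
  - i_ * (\sum_b dz a (dz b F) eta * (eta 0 b)^* - (dz a F eta)^*).
Proof.
move=> Ue.
have -> : (dz a F eta)^* = \sum_b (eta 0 b)^* * (dz a (dz b F) eta)^*.
  rewrite -[in LHS](euler_dz a Ue) conj_sum; apply: eq_bigr => b _; exact: conjM.
rewrite -sumrB mulr_sumr.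
by apply: eq_bigr => b _; rewrite /Nmx; move: (dz a _ _) => G; ring.
Qed.

(** Since [F_a] is the contraction of [F_{ab}] with eta, the potential is the hermitian form 2 Im
    [F_{ab}] evaluated at eta. *)
Lemma potential_Nmx eta : U eta ->
  \sum_a eta 0 a * \sum_b Nmx a b eta * (eta 0 b)^* = ofR (potential F eta).
Proof.
move=> Ue; rewrite /potential ofR_Im conj_sum.
transitivity (\sum_a - i_ * (eta 0 a * (\sum_b dz a (dz b F) eta * (eta 0 b)^*)
    - (dz a F eta * (eta 0 a)^*)^*)).
  apply: eq_bigr => a _; rewrite sum_Nmx// conj_mulJ.
  by move: (dz a F eta) (\sum_b _) => G S; ring.
rewrite -mulr_sumr sumrB; congr (_ * (_ - _)).
transitivity (\sum_a \sum_b eta 0 a * dz b (dz a F) eta * (eta 0 b)^*).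
  apply: eq_bigr => a _; rewrite mulr_sumr; apply: eq_bigr => b _.
  by rewrite (hol_dz_comm oU)// mulrA.
rewrite exchange_big/=; apply: eq_bigr => b _.
by rewrite -mulr_suml euler_dz.
Qed.

Lemma Re_le_norm (x : C) : ofR `|complex.Re x| <= `|x|.
Proof. exact: normc_ge_Re. Qed.

Lemma Re_continuous : continuous (fun x : C => complex.Re x).
Proof.
move=> x; have FF : Filter (nbhs (x : C)) := nbhs_filter (x : C).
apply/(@cvgrPdist_lt _ R^o _ (nbhs (x : C)) FF) => e e0.
have e0' : (0 : C) < ofR e by rewrite -ofR0 ltcR.
apply: (@filterS C (nbhs (x : C)) _ _ _ _ (nbhsx_ballx (x : C) _ e0')) => y xy.
rewrite -ReN -ReD -ltcR; apply: le_lt_trans (Re_le_norm _) _.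
exact: xy.
Qed.

(** Continuity makes the sign of the nonvanishing potential locally constant, so that it behaves as
    a constant under differentiation. *)
Lemma potential_continuous eta : U eta -> {for eta, continuous (potential F)}.
Proof.
move=> Ue.
have cc a : (fun x : V => x 0 a) @ eta --> eta 0 a by exact: coord_continuous.
have cRe (G : V -> C) (l : C) : G @ eta --> l -> complex.Re (G x) @[x --> eta] --> complex.Re l.
  by move=> h; apply: (cvg_comp _ _ h); exact: Re_continuous.
have ReI (x : C) : complex.Im x = complex.Re (- i_ * x) by rewrite !ReImE; ring.
have cIm (G : V -> C) (l : C) : G @ eta --> l -> complex.Im (G x) @[x --> eta] --> complex.Im l.
  move=> h; under eq_fun do rewrite ReI; rewrite ReI.
  by apply: (cRe (fun x => - i_ * G x)); apply: (@cvgM C V (nbhs eta) _ (fun=> - i_));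
    [exact: cvg_cst|].
have cF a : dz a F @ eta --> dz a F eta := hol_continuous (hol_dz_hol oU a hF) Ue.
have E x : potential F x = 2 * \sum_a (complex.Im (dz a F x) * complex.Re (x 0 a)
    - complex.Re (dz a F x) * complex.Im (x 0 a)).
  rewrite /potential; congr (_ * _); elim: index_enum => [|a r IH].
    by rewrite !big_nil.
  by rewrite !big_cons ImD IH; congr (_ + _); exact: Im_mulJ.
suff : potential F x @[x --> eta] --> potential F eta by [].
under eq_fun do rewrite E; rewrite E.
apply: (@cvgM R V (nbhs eta) _ (fun=> 2)); first exact: cvg_cst.
elim: index_enum => [|a r IH].
  by under eq_fun do rewrite big_nil; rewrite big_nil; exact: cvg_cst.
under eq_fun do rewrite big_cons; rewrite big_cons.
apply: (@cvgD R R^o V (nbhs eta) _ (fun x => complex.Im (dz a F x) * complex.Re (x 0 a)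
  - complex.Re (dz a F x) * complex.Im (x 0 a))); last exact: IH.
apply: (@cvgB R R^o V (nbhs eta) _ (fun x => complex.Im (dz a F x) * complex.Re (x 0 a))).
  by apply: (@cvgM R V (nbhs eta) _ (fun x => complex.Im (dz a F x)));
    [exact: cIm|exact: cRe].
by apply: (@cvgM R V (nbhs eta) _ (fun x => complex.Re (dz a F x)));
  [exact: cRe|exact: cIm].
Qed.

End Prepotential.

(** * Signs and scalar identities *)

Lemma sgr_close (R : realType) (a b : R) : `|b - a| < `|a| -> Num.sg b = Num.sg a.
Proof.
have [a0|a0|<-] := ltgtP 0 a; last by rewrite normr0 ltNge normr_ge0.
  rewrite (gtr0_norm a0) ltr_norml => /andP[h _].
  by rewrite !gtr0_sg//; rewrite ltrBrDl subrr in h.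
rewrite (ltr0_norm a0) ltr_norml => /andP[_ h].
by rewrite !ltr0_sg//; rewrite ltrBlDl subrr in h.
Qed.

Lemma ofR_sgr2 (R : realType) (a : R) : a != 0 ->
  ofR (Num.sg a) * ofR (Num.sg a) = 1.
Proof. by move=> a0; rewrite -ofRM -expr2 sqr_sg a0 ofR1. Qed.

Section ScalarIdentities.
Variable R : realType.
Local Notation C := (Cx R).

Lemma sum3Z n (c : C) (f g : 'I_n -> 'I_n -> 'I_n -> C) :
  (forall i j k, f i j k = c * g i j k) ->
  \sum_i \sum_j \sum_k f i j k = c * \sum_i \sum_j \sum_k g i j k.
Proof.
move=> fg; rewrite mulr_sumr; apply: eq_bigr => i _.
rewrite mulr_sumr; apply: eq_bigr => j _.
by rewrite mulr_sumr; apply: eq_bigr => k _.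
Qed.

Lemma eq_add3 (a b c a' b' c' : C) : a = a' -> b = b' -> c = c' ->
  a + b + c = a' + b' + c'.
Proof. by move=> -> -> ->. Qed.

Lemma sign_cancel (s a b : C) : s * s = 1 -> a * b = s * a * (s * b).
Proof. by move=> s2; rewrite mulrACA s2 mul1r. Qed.

Lemma scale_Xi (s a b y f f' : C) : s * s = 1 ->
  s * a * (s * b) * (2 * y ^+ 2 * f) * (2 * y ^+ 2 * f')^* =
  4 * (y * y^*) ^+ 2 * (a * b * f * f'^*).
Proof. by move=> /sign_cancel <-; rewrite !conjE; ring. Qed.

(** With [y'] the conjugate of [y], the factor [|y|^4] from the two Xi compensates the one in [K^2],
    and their factors 2 give the 4 of the denominator. *)
Lemma potential_scale (K k y y' S : C) : k != 0 -> y != 0 -> y' != 0 ->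
  K = y * y' * k -> k ^- 2 * S = (4 * K ^+ 2)^-1 * (4 * (y * y') ^+ 2 * S).
Proof. by move=> k0 y0 y0' ->; field; rewrite k0 y0 y0'. Qed.

End ScalarIdentities.

(** * Descent to the quotient: from homogeneous to affine coordinates *)

Section Quotient.
Variables (R : realType) (n : nat).
Local Notation C := (Cx R).
Local Notation V := 'rV[C]_n.
Local Notation V1 := 'rV[C]_n.+1.
Local Notation i_ := (imI R).
Local Notation lift0 := (lift (@ord0 n)).

Lemma dz_near (G H : V -> C) a x : (\forall y \near x, G y = H y) -> dz a G x = dz a H x.
Proof. by move=> GH; rewrite /dz !(dirC_near _ GH). Qed.

Lemma dzb_near (G H : V -> C) a x : (\forall y \near x, G y = H y) -> dzb a G x = dzb a H x.
Proof. by move=> GH; rewrite /dzb !(dirC_near _ GH). Qed.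

Local Opaque dz dzb.

Lemma hom_coord0 (y : C) (w : V) : hom_coord y w 0 ord0 = y.
Proof.
have e : (ord0 : 'I_n.+1) = lshift n (ord0 : 'I_1) by exact: val_inj.
transitivity (row_mx (const_mx y : 'rV[C]_1) (y *: w) 0 (lshift n (ord0 : 'I_1))).
  by rewrite -e.
by rewrite row_mxEl mxE.
Qed.

Lemma hom_coordS (y : C) (w : V) (i : 'I_n) : hom_coord y w 0 (lift0 i) = y * w 0 i.
Proof.
have e : lift0 i = rshift 1 i by exact: val_inj.
transitivity (row_mx (const_mx y : 'rV[C]_1) (y *: w) 0 (rshift 1 i)).
  by rewrite -e.
by rewrite row_mxEr mxE.
Qed.

Lemma hom_coordP (v w : V1) : v 0 ord0 = w 0 ord0 ->
  (forall i : 'I_n, v 0 (lift0 i) = w 0 (lift0 i)) -> v = w.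
Proof.
move=> h0 h; apply/rowP => j.
by have [i ->|->] := unliftP ord0 j.
Qed.

Lemma rowZE m (c : C) (A : 'rV[C]_m) i : (c *: A) 0 i = c * A 0 i.
Proof. by rewrite mxE. Qed.
Lemma rowDE m (A B : 'rV[C]_m) i : (A + B) 0 i = A 0 i + B 0 i.
Proof. by rewrite mxE. Qed.
Lemma rowBE m (A B : 'rV[C]_m) i : (A - B) 0 i = A 0 i - B 0 i.
Proof. by rewrite !mxE. Qed.
Lemma stdbE m (a b : 'I_m) : stdb R a 0 b = (b == a)%:R.
Proof. by rewrite mxE. Qed.

(** For fixed [y] a real line in z goes to a real line in eta with direction scaled by [y], so
    directional derivatives transfer directly. *)
Lemma hom_coord_line (y c : C) (w : V) (t : R) (i : 'I_n) :
  hom_coord y (w + ofR t *: (c *: stdb R i)) =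
  hom_coord y w + ofR t *: ((y * c) *: stdb R (lift0 i)).
Proof.
apply: hom_coordP => [|j]; rewrite rowDE !rowZE stdbE ?hom_coord0 ?hom_coordS.
  by rewrite (negPf (neq_lift _ _)) !mulr0 addr0.
rewrite rowDE !rowZE stdbE (inj_eq lift_inj).
by ring.
Qed.

Lemma hom_coordZ (l y : C) (w : V) : l *: hom_coord y w = hom_coord (l * y) w.
Proof.
by apply: hom_coordP => [|j]; rewrite rowZE ?hom_coord0 ?hom_coordS// mulrA.
Qed.

Lemma hom_coord_continuous (y : C) : continuous (@hom_coord R n y).
Proof.
move=> w N [P hP PN]; have FF : Filter (nbhs w) := nbhs_filter w.
have h (j : 'I_n.+1) : \forall w' \near w, P 0 j (hom_coord y w' 0 j).
  have [i ->|->] := unliftP ord0 j; last first.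
    apply: (@filterE _ (nbhs w) FF) => w'; rewrite hom_coord0 -[X in P _ _ X](hom_coord0 y w).
    exact: nbhs_singleton.
  have hc : y * w' 0 i @[w' --> w] --> hom_coord y w 0 (lift0 i).
    rewrite hom_coordS; apply: (@cvgM C V (nbhs w) _ (fun=> y)); first exact: cvg_cst.
    exact: coord_continuous.
  by apply: (@filterS _ (nbhs w) FF _ _ _ (hc _ (hP 0 (lift0 i)))) => w' /=; rewrite hom_coordS.
have {}h := @filter_forall _ _ _ _ (nbhs_filter w) h.
by apply: (@filterS _ (nbhs w) FF _ _ _ h) => w' hw'; apply: PN => i j; rewrite (ord1 i); exact: hw'.
Qed.

Variables (U : set V1) (F : V1 -> C).
Hypothesis oU : open U.
Hypothesis hF : holomorphic U F.
Hypothesis Fhom : forall (l : C) eta, l != 0 -> U eta -> F (l *: eta) = l ^+ 2 * F eta.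
Hypothesis KU : forall eta, U eta -> potential F eta != 0.
Hypothesis NU : forall eta, U eta -> forall v : V1,
  (forall b, \sum_a v 0 a * Nmx F a b eta = 0) -> v = 0.
Variable y : C.
Hypothesis y0 : y != 0.

Definition affine_dom : set V := [set w | U (hom_coord y w)].
Local Notation W := affine_dom.

Lemma affine_dom_open : open W.
Proof. by apply: open_comp oU => w _; exact: hom_coord_continuous. Qed.

Lemma isW_hom G i w : holomorphic U G -> W w ->
  isW i (fun w => G (hom_coord y w)) w (y * dz (lift0 i) G (hom_coord y w)) 0.
Proof.
move=> hG Ww.
have h (c : C) : isdC (fun t => G (hom_coord y (w + ofR t *: (c *: stdb R i))))
    (y * c * dz (lift0 i) G (hom_coord y w)).
  under eq_fun do rewrite hom_coord_line.
  by rewrite -(hol_dirZ oU _ _ hG Ww); apply: (smoothC_isdC _ hG.1 Ww).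
split; last by apply: isdC_eq (h i_) _; ring.
by have := h 1; rewrite scale1r => h1; apply: isdC_eq h1 _; ring.
Qed.

(* [aff] is f = F(1, z).  F is known to be holomorphic only near (y, y z), so the
   derivatives of f are expressed by those of F there. *)
Definition aff (w : V) : C := F (hom_coord 1 w).
Definition aff1 i (w : V) : C := y^-1 * dz (lift0 i) F (hom_coord y w).
Definition aff2 i j (w : V) : C := dz (lift0 i) (dz (lift0 j) F) (hom_coord y w).
Definition aff3 i j k (w : V) : C :=
  y * dz (lift0 i) (dz (lift0 j) (dz (lift0 k) F)) (hom_coord y w).

(** Homogeneity with factor [1 / y] carries [(y, y z)] to [(1, z)], which itself may lie outside
    [U]. *)
Lemma affE w : W w -> aff w = y ^- 2 * F (hom_coord y w).
Proof.
move=> Ww; rewrite -exprVn -Fhom ?invr_eq0// hom_coordZ mulVf//.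
Qed.

Lemma near_aff w : W w -> \forall w' \near w, W w'.
Proof. by move=> Ww; apply: open_nbhs_nbhs; split=> //; exact: affine_dom_open. Qed.

Lemma isW_aff w i : W w -> isW i aff w (aff1 i w) 0.
Proof.
move=> Ww; apply: isW_near (isW_eq (isWZ (y ^- 2) (isW_hom i hF Ww)) _ _).
- by apply: filterS (near_aff Ww) => w' Ww'; apply/esym; exact: affE.
- by rewrite /aff1 -exprVn; move: (dz _ _ _) => G; field.
- by rewrite mulr0.
Qed.

Lemma isW_aff1 w i j : W w -> isW i (aff1 j) w (aff2 i j w) 0.
Proof.
move=> Ww; apply: isW_eq (isWZ y^-1 (isW_hom i (hol_dz_hol oU (lift0 j) hF) Ww)) _ _.
  by rewrite /aff2 mulrA mulVf ?mul1r.
by rewrite mulr0.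
Qed.

Lemma isW_aff2 w i j k : W w -> isW i (aff2 j k) w (aff3 i j k w) 0.
Proof.
move=> Ww.
exact: (isW_hom i (hol_dz_hol oU (lift0 j) (hol_dz_hol oU (lift0 k) hF)) Ww).
Qed.

Lemma isW_aff3 w l i j k : W w -> exists d, isW l (aff3 i j k) w d 0.
Proof.
move=> Ww; eexists; apply: isW_eq (isWZ y (isW_hom l (hol_dz_hol oU (lift0 i)
  (hol_dz_hol oU (lift0 j) (hol_dz_hol oU (lift0 k) hF))) Ww)) (erefl _) _.
by rewrite mulr0.
Qed.

Lemma aff2C w i j : W w -> aff2 i j w = aff2 j i w.
Proof. by move=> Ww; exact: (hol_dz_comm oU (lift0 i) (lift0 j) hF Ww). Qed.

Lemma aff3C w i j k : W w -> aff3 i j k w = aff3 j i k w.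
Proof.
move=> Ww; exact: (congr1 ( *%R y) (hol_dz_comm oU (lift0 i) (lift0 j)
  (hol_dz_hol oU (lift0 k) hF) Ww)).
Qed.

Lemma dz_aff3 w i j k : W w -> dz i (dz j (dz k aff)) w = aff3 i j k w.
Proof.
move=> Ww.
have e1 w' : W w' -> dz k aff w' = aff1 k w' by move=> /(isW_aff k)/isW_dz.
have e2 w' : W w' -> dz j (dz k aff) w' = aff2 j k w'.
  move=> Ww'; rewrite -(isW_dz (isW_aff1 j k Ww')); apply: dz_near.
  by apply: filterS (near_aff Ww'); exact: e1.
rewrite -(isW_dz (isW_aff2 i j k Ww)); apply: dz_near.
by apply: filterS (near_aff Ww); exact: e2.
Qed.

Local Notation kf := (kf aff aff1).
Local Notation k1 := (k1 aff1 aff2).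
Local Notation th := (th aff aff1 aff2).
Local Notation hm := (hm aff aff1 aff2).

Lemma aff_dz i w : dz (lift0 i) F (hom_coord y w) = y * aff1 i w.
Proof. by rewrite /aff1 mulVKf. Qed.

Lemma Kpot_kf w : W w -> ofR (Kpot F y w) = y * y^* * kf w.
Proof.
move=> Ww; have E := hol_euler oU hF Ww Fhom.
rewrite big_ord_recl hom_coord0 in E.
(* Euler's identity solved for the derivative in the direction [eta^0]. *)
have E1 : dz ord0 F (hom_coord y w) = y * (2 * aff w - \sum_i w 0 i * aff1 i w).
  apply: (mulfI y0); rewrite (canRL (addrK _) E) affE//.
  rewrite (eq_bigr (fun i => y ^+ 2 * (w 0 i * aff1 i w))).
    by rewrite -mulr_sumr -exprVn; move: (F _) (\sum_i _) => G S; field.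
  by move=> i _; rewrite hom_coordS aff_dz; ring.
rewrite /Kpot /potential ofR_Im big_ord_recl hom_coord0.
rewrite (eq_bigr (fun i => y * y^* * ((w 0 i)^* * aff1 i w))); last first.
  by move=> i _; rewrite hom_coordS aff_dz conjM; ring.
rewrite E1 -mulr_sumr /kf.
rewrite [\sum_m imx m w * _](eq_bigr (fun i => w 0 i * aff1 i w - (w 0 i)^* * aff1 i w
  + (w 0 i * (aff1 i w)^* - (w 0 i)^* * (aff1 i w)^*))); last first.
  by move=> i _; rewrite /imx; ring.
rewrite big_split/= !sumrB.
have e1 : (\sum_i w 0 i * aff1 i w)^* = \sum_i (w 0 i)^* * (aff1 i w)^*.
  by rewrite conj_sum; apply: eq_bigr => i _; exact: conjM.
have e2 : (\sum_i (w 0 i)^* * aff1 i w)^* = \sum_i w 0 i * (aff1 i w)^*.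
  by rewrite conj_sum; apply: eq_bigr => i _; rewrite conjM conjCK.
rewrite -e1 -e2; move: (aff w) (\sum_i _) (\sum_i _) => G S1 S2.
by rewrite !conjE; ring.
Qed.

Lemma kf_neq0 w : W w -> kf w != 0.
Proof.
move=> Ww; have := KU Ww; apply: contra => /eqP e.
by rewrite -ofR_eq0 -/(Kpot F y w) Kpot_kf// e mulr0.
Qed.

(** Contracting 2 Im [F_{ab}] with conj(eta) gives the derivative of the potential along [eta^i];
    the mixed derivative with index 0 is eliminated by [euler_dz]. *)
Lemma sum_Nmx_k1 i w : W w ->
  \sum_b Nmx F (lift0 i) b (hom_coord y w) * (hom_coord y w 0 b)^* = y^* * k1 i w.
Proof.
move=> Ww; rewrite (sum_Nmx oU hF Fhom _ Ww) aff_dz.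
have E := euler_dz oU hF Fhom (lift0 i) Ww.
rewrite big_ord_recl hom_coord0 aff_dz in E.
have E1 : dz (lift0 i) (dz ord0 F) (hom_coord y w) = aff1 i w - \sum_j w 0 j * aff2 i j w.
  apply: (mulfI y0); rewrite (canRL (addrK _) E) mulrBr; congr (_ - _).
  by rewrite mulr_sumr; apply: eq_bigr => j _; rewrite hom_coordS; exact: (esym (mulrA _ _ _)).
rewrite big_ord_recl hom_coord0.
rewrite (eq_bigr (fun j => y^* * ((w 0 j)^* * aff2 i j w))); last first.
  by move=> j _; rewrite hom_coordS [(y * _)^*]conjM /aff2; move: (dz _ _ _) => G; ring.
rewrite E1 /k1.
rewrite [\sum_m imx m w * _](eq_bigr (fun j => w 0 j * aff2 i j w - (w 0 j)^* * aff2 i j w)).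
  rewrite -mulr_sumr sumrB [(y * _)^*]conjM.
  by move: (aff1 i w) => G; ring.
by move=> j _; rewrite /imx; ring.
Qed.

Lemma hm_unit w : W w -> \matrix_(i, j) hm i j w \in unitmx.
Proof.
move=> Ww; rewrite -row_free_unit; apply: inj_row_free => v vH.
have k0 := kf_neq0 Ww; have yb0 : y^* != 0 by rewrite conjC_eq0.
pose mu := \sum_i v 0 i * th i w.
(* For [v] in the left kernel of h, contraction with [k11] reduces to the rank one term of h. *)
have e11 j : \sum_i v 0 i * k11 aff2 i j w = mu * (k1 j w)^*.
  have := congr1 (fun u : V => u 0 j) vH; rewrite !mxE => e.
  rewrite (eq_bigr (fun i => kf w * (v 0 i * (\matrix_(i, j) hm i j w) i j)
    + v 0 i * th i w * (k1 j w)^*)).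
    by rewrite big_split/= -mulr_sumr e mulr0 add0r -mulr_suml.
  move=> i _; rewrite !mxE {1}/hm {2}/th conj_div conj_kf; move: (th i w) => t.
  by field.
(* The first two terms give [(0, v)]; the last is its orthogonal projection to eta for the form 2 Im
   [F_{ab}]. *)
pose u : V1 := hom_coord 1 v - hom_coord 1 0 - (mu / y) *: hom_coord y w.
have u0 : u 0 ord0 = - mu.
  by rewrite !rowBE rowZE !hom_coord0; field.
have uS i : u 0 (lift0 i) = v 0 i - mu / y * (y * w 0 i).
  by rewrite !rowBE rowZE !hom_coordS mxE; ring.
have uE (g : 'I_n.+1 -> C) : \sum_a u 0 a * g a =
    \sum_i v 0 i * g (lift0 i) - mu / y * \sum_a hom_coord y w 0 a * g a.
  rewrite big_ord_recl u0 [X in _ = _ - _ * X]big_ord_recl hom_coord0.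
  rewrite (eq_bigr (fun i => v 0 i * g (lift0 i) - mu / y * (hom_coord y w 0 (lift0 i) * g (lift0 i)))).
    by rewrite sumrB -mulr_sumr; field.
  by move=> i _; rewrite uS hom_coordS; ring.
clearbody u.
have NS j : \sum_a u 0 a * Nmx F a (lift0 j) (hom_coord y w) = 0.
  rewrite uE.
  have -> : \sum_a hom_coord y w 0 a * Nmx F a (lift0 j) (hom_coord y w) = y * (k1 j w)^*.
    rewrite -[y in RHS]conjCK -conjM -sum_Nmx_k1// conj_sum; apply: eq_bigr => a _.
    by rewrite conj_mulJ conj_Nmx (NmxC oU hF _ _ Ww) mulrC.
  by rewrite -[\sum_i _]/(\sum_i v 0 i * k11 aff2 i j w) e11; field.
(* The vector [u] is orthogonal to eta. As its contractions with the indices above 0 vanish, only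
   index 0 is left, with the nonzero factor conj(y). *)
have N0 : \sum_a u 0 a * Nmx F a ord0 (hom_coord y w) = 0.
  have : \sum_b (\sum_a u 0 a * Nmx F a b (hom_coord y w)) * (hom_coord y w 0 b)^* = 0.
    transitivity (\sum_a u 0 a * \sum_b Nmx F a b (hom_coord y w) * (hom_coord y w 0 b)^*).
      under eq_bigr do rewrite mulr_suml.
      rewrite exchange_big/=; apply: eq_bigr => a _; rewrite mulr_sumr.
      by apply: eq_bigr => b _; rewrite mulrA.
    rewrite uE (potential_Nmx oU hF Fhom Ww) -/(Kpot F y w) Kpot_kf//.
    rewrite (eq_bigr (fun i => y^* * kf w * (v 0 i * th i w))).
      by rewrite -mulr_sumr -/mu; field.
    by move=> i _; rewrite sum_Nmx_k1// /th; move: (k1 i w) => t; field.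
  rewrite big_ord_recl hom_coord0 [X in _ + X]big1; last by move=> j _; rewrite NS mul0r.
  move: (\sum_a _) => S; rewrite addr0 => e.
  by apply: (mulIf yb0); rewrite e mul0r.
have {}u_eq0 : u = 0.
  apply: (NU Ww) => b; have [j ->|->] := unliftP ord0 b; [exact: NS|exact: N0].
(* The component 0 of [u] is [- mu], so the projection vanishes and [u] reduces to [(0, v)]. *)
have mu0 : mu = 0 by apply/eqP; rewrite -oppr_eq0 -u0 u_eq0 mxE.
by apply/rowP => i; have := uS i; rewrite mu0 mul0r mul0r subr0 u_eq0 !mxE.
Qed.

Local Notation dh := (dh aff aff1 aff2 aff3).
Local Notation Gam := (Gam aff aff1 aff2 aff3).
Local Notation hi := (hi aff aff1 aff2).

Lemma Ksign_near w : W w -> \forall w' \near w, Ksign F y w' = Ksign F y w.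
Proof.
move=> Ww; have c : {for w, continuous (Kpot F y)}.
  apply: (@continuous_comp _ _ _ (hom_coord y) (potential F)).
    exact: hom_coord_continuous.
  exact: (potential_continuous oU hF Ww).
have K0 : 0 < `|Kpot F y w| by rewrite normr_gt0; exact: KU.
apply: filterS (cvg_dist c K0) => w' h.
exact: (congr1 (@ofR R) (sgr_close h)).
Qed.

Lemma Ksign2 w : W w -> Ksign F y w * Ksign F y w = 1.
Proof. by move=> Ww; exact: ofR_sgr2 (KU Ww). Qed.

(** The potential is [|y|^2 k], and the constant factor [|y|^2] drops out of a logarithmic
    derivative. *)
Lemma dzb_ln_Kpot j w : W w ->
  dzb j (fun w => ofR (ln `|Kpot F y w|)) w = (th j w)^*.
Proof.
move=> Ww; have k0 := kf_neq0 Ww; have yb0 : y^* != 0 by rewrite conjC_eq0.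
have h := isWZ (y * y^*) (isW_kf isW_aff isW_aff1 j Ww).
have {}h : isW j (fun w => ofR (Kpot F y w)) w (y * y^* * k1 j w) (y * y^* * (k1 j w)^*).
  by apply: isW_near h; apply: filterS (near_aff Ww) => w' Ww'; apply/esym; exact: Kpot_kf.
rewrite (isW_dzb (isW_ln (KU Ww : Kpot F y w != 0) h)) Kpot_kf// /th conj_div conj_kf.
by move: ((k1 j w)^*) => t; field; rewrite k0 yb0.
Qed.

Lemma gM_hm i j w : W w -> gM F y i j w = Ksign F y w * hm i j w.
Proof.
move=> Ww; rewrite /gM; congr (_ * _).
have h := isWJ (isW_th isW_aff isW_aff1 isW_aff2 aff2C kf_neq0 i j Ww).
rewrite -(conj_hm aff aff1 aff2C j i Ww) -(isW_dz h); apply: dz_near.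
by apply: filterS (near_aff Ww) => w'; exact: dzb_ln_Kpot.
Qed.

(** The sign is its own inverse, so it passes unchanged from the metric to the inverse metric. *)
Lemma gMinv_hi j m w : W w -> gMinv F y j m w = Ksign F y w * hi j m w.
Proof.
move=> Ww; rewrite /gMinv /hi.
have s2 := Ksign2 Ww.
have -> : \matrix_(k, l) gM F y k l w = Ksign F y w *: \matrix_(k, l) hm k l w.
  by apply/matrixP => k l; rewrite !mxE gM_hm.
have s0 : Ksign F y w \is a GRing.unit.
  by rewrite unitfE; apply/eqP => e; move/eqP: s2; rewrite e mul0r eq_sym oner_eq0.
rewrite invmxZ; last by rewrite unitmxZ//; exact: hm_unit.
rewrite [LHS]mxE; congr (_ * _).
by apply: (mulrI s0); rewrite mulrV// s2.
Qed.

(** The sign is locally constant, so it leaves the derivative as a factor and cancels against the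
    sign of the inverse metric. *)
Lemma GammaM_Gam j i k w : W w -> GammaM F y j i k w = Gam j i k w.
Proof.
move=> Ww; rewrite /GammaM /Gam; apply: eq_bigr => m _; rewrite gMinv_hi//.
have h := isWZ (Ksign F y w) (isW_hm affine_dom_open isW_aff isW_aff1 isW_aff2 aff2C kf_neq0 i k m Ww).
have -> : dz i (gM F y k m) w = Ksign F y w * dh i k m w.
  rewrite -(isW_dz h); apply: dz_near.
  apply: filterS (filterI (near_aff Ww) (Ksign_near Ww)) => w' [Ww' e].
  by rewrite (gM_hm k m Ww'); exact: (congr1 (fun s => s * hm k m w') e).
by rewrite mulrACA (Ksign2 Ww) mul1r.
Qed.

Lemma curvM_aff j i k l w : W w -> curvM F y j i k l w =
  (4 * ofR (Kpot F y w) ^+ 2)^-1 *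
    (\sum_(j' < n) \sum_(p < n) \sum_(q < n)
      gMinv F y j j' w * gMinv F y p q w * Xi F y p k i w * (Xi F y q j' l w)^*)
  + Ksign F y w * (i == j)%:R * gM F y k l w
  + Ksign F y w * (j == k)%:R * gM F y i l w.
Proof.
move=> Ww; have k0 := kf_neq0 Ww; have yb0 : y^* != 0 by rewrite conjC_eq0.
rewrite /curvM.
have -> : dzb l (GammaM F y j i k) w = dzb l (Gam j i k) w.
  by apply: dzb_near; apply: filterS (near_aff Ww) => w'; exact: GammaM_Gam.
rewrite (dzb_Gam affine_dom_open isW_aff isW_aff1 isW_aff2 isW_aff3 aff2C aff3C
  kf_neq0 hm_unit l j i k Ww) !gM_hm//.
have T j' p q : gMinv F y j j' w * gMinv F y p q w * Xi F y p k i w * (Xi F y q j' l w)^* =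
    4 * (y * y^*) ^+ 2 * (hi j j' w * hi p q w * aff3 p k i w * (aff3 q j' l w)^*).
  rewrite (gMinv_hi j j' Ww) (gMinv_hi p q Ww) /Xi (dz_aff3 p k i Ww) (dz_aff3 q j' l Ww).
  exact: scale_Xi (Ksign2 Ww).
apply: eq_add3; first last.
- exact: sign_cancel (Ksign2 Ww).
- exact: sign_cancel (Ksign2 Ww).
apply: etrans _ (congr1 _ (esym (sum3Z T))).
exact: potential_scale (Kpot_kf Ww).
Qed.

End Quotient.
(** * The metric in special coordinates *)

Section HermitianForm.
Variables (R : realType) (m : nat).
Local Notation C := (Cx R).
Local Notation V := 'rV[C]_m.
Local Notation i_ := (imI R).
Variable B : V -> V -> R.
Hypothesis Blin : forall (a : R) (u v w : V), B (ofR a *: u + v) w = a * B u w + B v w.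
Hypothesis Bsym : forall v w, B v w = B w v.
Hypothesis BJ : forall v w, B (i_ *: v) (i_ *: w) = B v w.

Lemma form0l w : B 0 w = 0.
Proof. by have := Blin 1 0 0 w; rewrite scaler0 addr0 mul1r -[X in X = _ -> _]addr0 => /addrI. Qed.
Lemma formDl u v w : B (u + v) w = B u w + B v w.
Proof. by rewrite -[u in LHS]scale1r -ofR1 Blin mul1r. Qed.
Lemma formZl a v w : B (ofR a *: v) w = a * B v w.
Proof. by rewrite -[_ *: _]addr0 Blin form0l addr0. Qed.
Lemma formNl v w : B (- v) w = - B v w.
Proof. by rewrite -scaleN1r -ofR1 -ofRN formZl mulN1r. Qed.
Lemma formZr a v w : B v (ofR a *: w) = a * B v w.
Proof. by rewrite Bsym formZl Bsym. Qed.
Lemma formNr v w : B v (- w) = - B v w.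
Proof. by rewrite Bsym formNl Bsym. Qed.
Lemma scaleJJ (v : V) : i_ *: (i_ *: v) = - v.
Proof. by rewrite scalerA imI2 scaleN1r. Qed.
Lemma formJl v w : B (i_ *: v) w = - B v (i_ *: w).
Proof. by rewrite -BJ scaleJJ formNl. Qed.

(** The complex bilinear extension of [B] on a (1,0)-vector and the conjugate of another: a
    hermitian form whose matrix in the standard basis is [gcomp]. *)
Definition herm (v w : V) : C := metricC B (type10 v) (cconj (type10 w)).

Lemma hermE v w : herm v w = 2^-1 * (ofR (B v w) + i_ * ofR (B v (i_ *: w))).
Proof.
have -> : herm v w = Complex (2^-1 * B v w) (2^-1 * B v (i_ *: w)).
  rewrite /herm /metricC /type10 /cconj /= opprK !formNl !formZl !formZr BJ formJl.
  by congr Complex; field.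
have -> : (2^-1 : C) = ofR 2^-1 by rewrite ofRV ofR_nat.
by apply: CxP; rewrite [LHS]/= !ReImE; ring.
Qed.

Lemma herm_conj v w : herm w v = (herm v w)^*.
Proof.
have -> : herm v w = 2^-1 * (ofR (B v w) + i_ * ofR (B v (i_ *: w))) := hermE v w.
by rewrite hermE !conjE (Bsym w v) (Bsym w) formJl ofRN; ring.
Qed.

Lemma hermDl u v w : herm (u + v) w = herm u w + herm v w.
Proof. by rewrite !hermE !formDl !ofRD; ring. Qed.

Lemma hermZl c v w : herm (c *: v) w = c * herm v w.
Proof.
have hr a u : herm (ofR a *: u) w = ofR a * herm u w.
  by rewrite !hermE !formZl !ofRM; ring.
have hJ u : herm (i_ *: u) w = i_ * herm u w.
  rewrite !hermE !formJl scaleJJ formNr opprK ofRN.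
  by have i2 := imI2 R; ring: i2.
rewrite [in LHS](ReImC c) scalerDl hermDl -scalerA hJ !hr mulrA -mulrDl.
by rewrite -ReImC.
Qed.

Lemma herm_sum v w : herm v w =
  \sum_a \sum_b v 0 a * (w 0 b)^* * herm (stdb R a) (stdb R b).
Proof.
have hl u : herm v u = \sum_a v 0 a * herm (stdb R a) u.
  rewrite [in LHS](row_sum_delta v); elim: index_enum => [|a r IH].
    by rewrite !big_nil -(scale0r (0 : V)) hermZl mul0r.
  by rewrite !big_cons hermDl hermZl IH.
rewrite hl; apply: eq_bigr => a _; rewrite herm_conj.
have -> : herm w (stdb R a) = \sum_b w 0 b * herm (stdb R b) (stdb R a).
  rewrite [in LHS](row_sum_delta w); elim: index_enum => [|b r IH].
    by rewrite !big_nil -(scale0r (0 : V)) hermZl mul0r.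
  by rewrite !big_cons hermDl hermZl IH.
rewrite conj_sum mulr_sumr; apply: eq_bigr => b _.
by rewrite conjM -herm_conj mulrA.
Qed.

End HermitianForm.

(** * The metric and the vector field H in special coordinates *)

Section SpecialKahlerCharts.
Variables (R : realType) (n : nat) (P : projective_special_kahler R n).
Local Notation C := (Cx R).
Variables (phi : chart R (psk_tot P) n.+1) (F : 'rV[C]_n.+1 -> C).
Hypothesis Hspecial : special_coordinates phi F.
Hypothesis HH : forall p, cdom phi p ->
  fundH (@psk_act R n P) phi p = ofR (psk_c P) *: ccoord phi p.
Hypothesis Hhom : forall (l : C) (eta : 'rV[C]_n.+1), l != 0 -> cimg phi eta ->
  F (l *: eta) = l ^+ 2 * F eta.

Let U := cimg phi.

Lemma special_chart : is_chart phi.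
Proof. exact: atlas_chart (spc_atlas Hspecial). Qed.

Lemma open_cimg : open U.
Proof. by have [] := special_chart. Qed.

Let hF : holomorphic U F := spc_holomorphic Hspecial.

Lemma herm_localG eta v w : U eta -> herm (localG phi eta) v w =
  \sum_a \sum_b v 0 a * (w 0 b)^* * Nmx F a b eta.
Proof.
move=> Ue; have pk := rsk_kahler (spc_atlas Hspecial).
rewrite herm_sum.
- apply: eq_bigr => a _; apply: eq_bigr => b _; congr (_ * _).
  have [_ h] := spc_metric Hspecial Ue a b.
  by apply: etrans h _; exact: ofR_Im.
- by move=> a u u' u''; exact: (pk_linear pk Ue).
- by move=> u u'; exact: (pk_sym pk Ue).
- by move=> u u'; exact: (pk_hermitian pk Ue).
Qed.

(** A kernel vector of the matrix is orthogonal to everything for [herm], whose real part is half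
    the metric; the metric is nondegenerate. *)
Lemma Nmx_nondeg eta : U eta -> forall v : 'rV[C]_n.+1,
  (forall b, \sum_a v 0 a * Nmx F a b eta = 0) -> v = 0.
Proof.
move=> Ue v hv; have pk := rsk_kahler (spc_atlas Hspecial).
apply: (pk_nondeg pk Ue) => w.
have : herm (localG phi eta) v w = 0.
  rewrite herm_localG// exchange_big/= big1// => b _.
  transitivity ((w 0 b)^* * \sum_a v 0 a * Nmx F a b eta); last by rewrite hv mulr0.
  by rewrite mulr_sumr; apply: eq_bigr => a _; rewrite mulrA [(w 0 b)^* * _]mulrC.
rewrite hermE.
- move=> /eqP; rewrite mulf_eq0 invr_eq0 pnatr_eq0/= => /eqP/(congr1 (@complex.Re R)).
  by rewrite !ReImE mulr0 mul0r subr0 addr0.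
- by move=> a u u' u''; exact: (pk_linear pk Ue).
- by move=> u u'; exact: (pk_sym pk Ue).
- by move=> u u'; exact: (pk_hermitian pk Ue).
Qed.

(** As H is c times eta, [gHH] is the hermitian form at eta times [c^2], which [potential_Nmx]
    evaluates. *)
Lemma gHH_potential p : cdom phi p ->
  gHH (@psk_act R n P) phi p = ofR (psk_c P) ^+ 2 * ofR (potential F (ccoord phi p)).
Proof.
move=> Hp; have Ue : U (ccoord phi p) by exists p.
have pk := rsk_kahler (spc_atlas Hspecial).
have [_ _ cpK _ _] := special_chart.
have -> : gHH (@psk_act R n P) phi p =
    herm (localG phi (ccoord phi p)) (ofR (psk_c P) *: ccoord phi p)
      (ofR (psk_c P) *: ccoord phi p).
  by rewrite /gHH HH// /localG cpK.
rewrite herm_localG// -(potential_Nmx open_cimg hF Hhom Ue) mulr_sumr.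
apply: eq_bigr => a _; rewrite !mulr_sumr; apply: eq_bigr => b _.
rewrite !rowZE conjM conj_ofR; move: (Nmx _ _ _ _) => N.
by ring.
Qed.

Lemma potential_neq0 eta : U eta -> potential F eta != 0.
Proof.
move=> [p Hp <-]; have := psk_gHH_neq0 (spc_atlas Hspecial) Hp.
by rewrite gHH_potential// mulf_eq0 negb_or ofR_eq0 => /andP[].
Qed.

Lemma hom_aff_coord (eta : 'rV[C]_n.+1) : eta 0 ord0 != 0 ->
  hom_coord (eta 0 ord0) (aff_coord eta) = eta.
Proof.
move=> e0; apply: hom_coordP => [|i]; first exact: hom_coord0.
by rewrite hom_coordS mxE mulrC divfK.
Qed.

End SpecialKahlerCharts.

(** * The curvature of the quotient at a point of the special chart *)

Unset Implicit Arguments.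

Theorem mainTheorem3 (R : realType) (n : nat)
  (P : projective_special_kahler R n)
  (phi : chart R (psk_tot P) n.+1) (F : 'rV[Cx R]_n.+1 -> Cx R)
  (Hspecial : special_coordinates phi F)
  (Heta0 : forall p, cdom phi p -> ccoord phi p 0 ord0 != 0)
  (HH : forall p, cdom phi p ->
     fundH (@psk_act R n P) phi p = ofR (psk_c P) *: ccoord phi p)
  (Hhom : forall (l : Cx R) (eta : 'rV[Cx R]_n.+1), l != 0 -> cimg phi eta ->
     F (l *: eta) = l ^+ 2 * F eta)
  (p : psk_tot P) (Hp : cdom phi p) :
  let eta := ccoord phi p in
  let y := eta 0 ord0 in
  let z := aff_coord eta in
  let K := ofR (potential F eta) in
  let g i j := gM F y i j z in
  let ginv i j := gMinv F y i j z in
  let Xi i j k := Xi F y i j k z in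
  let s := Ksign F y z in
  K = gHH (@psk_act R n P) phi p / ofR (psk_c P) ^+ 2 /\
  forall j i k l : 'I_n,
    curvM F y j i k l z =
      (4 * K ^+ 2)^-1 *
        (\sum_(j' < n) \sum_(p' < n) \sum_(q < n)
           ginv j j' * ginv p' q * Xi p' k i * (Xi q j' l)^*)
      + s * (i == j)%:R * g k l
      + s * (j == k)%:R * g i l.
Proof.
move=> eta y z K g ginv Xi s.
have Ue : cimg phi eta by exists p.
have y0 : y != 0 := Heta0 p Hp.
(* Since [eta^0] is nonzero, eta is recovered from [y] and [z]; this places [z] in the affine domain
   and identifies [K] with [Kpot]. *)
have zE : hom_coord y z = eta := hom_aff_coord y0.
have Wz : affine_dom (cimg phi) y z by rewrite /affine_dom /= zE.
have KE : ofR (Kpot F y z) = K by rewrite /Kpot zE.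
split.
  have c0 : ofR (psk_c P) != 0 :> Cx R by rewrite ofR_eq0 psk_c_neq0.
  rewrite (gHH_potential Hspecial HH Hhom Hp) mulrC mulKf//.
  by rewrite expf_neq0.
move=> j i k l; rewrite -KE.
exact: (curvM_aff (open_cimg Hspecial) (spc_holomorphic Hspecial) Hhom
  (potential_neq0 Hspecial HH Hhom) (Nmx_nondeg Hspecial) y0 j i k l Wz).
Qed.
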